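(* Let $\Pi$ be a set of permutations and $n$ a positive integer. If $Q_n(\Pi)$ is symmetric then so is $Q_n(\Pi^r)$. In particular, if $Q_n(\Pi)=\sum_{\lambda}c_\lambda s_\lambda$ (sum over partitions $\lambda$ of $n$) for certain coefficients $c_\lambda$, then $$Q_n(\Pi^r)=\sum_\lambda c_\lambda s_{\lambda^t}.$$
   Context: $\mathfrak{S}_n$ is the set of permutations of $[n]$ in one-line notation. For $\pi=\pi_1\pi_2\cdots\pi_m\in\mathfrak{S}_m$ the reversal is $\pi^r=\pi_m\cdots\pi_2\pi_1$, and $\Pi^r=\{\pi^r\mid\pi\in\Pi\}$. A permutation $\sigma$ contains $\pi$ as a pattern if some (not necessarily consecutive) subsequence of $\sigma$ is order-isomorphic to $\pi$; otherwise it avoids $\pi$. $\mathfrak{S}_n(\Pi)$ is the set of $\sigma\in\mathfrak{S}_n$ avoiding every $\pi\in\Pi$. $\mathrm{Des}\,\sigma=\{i\mid\sigma_i>\sigma_{i+1}\}\subseteq[n-1]$. For $S\subseteq[n-1]$, $F_S=\sum x_{i_1}\cdots x_{i_n}$ over all $i_1\le\dots\le i_n$ with $i_s<i_{s+1}$ whenever $s\in S$. $Q_n(\Pi)=\sum_{\sigma\in\mathfrak{S}_n(\Pi)}F_{\mathrm{Des}\,\sigma}$. $s_\lambda$ is the Schur function and $\lambda^t$ the transpose (conjugate) partition of $\lambda$. *)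

(* Defs.v *)
From HB Require Import structures.
From mathcomp Require Import all_boot all_order all_algebra all_fingroup.
From mathcomp Require Import finmap multiset.
From mathcomp Require Import boolp.

Set Implicit Arguments.
Unset Strict Implicit.
Unset Printing Implicit Defensive.

Import GRing.Theory.
Local Open Scope mset_scope.

(* Permutations of [n] are elements of 'S_n, acting on {0, ..., n-1}: the      *)
(* one-line notation of s is s 0, s 1, ..., s (n-1).                           *)

(* A set of permutations of arbitrary (unbounded) lengths, sorted by length.   *)
Definition patterns := forall m : nat, {set 'S_m}.

(* In mathcomp (s * t) i = t (s i), so this is i |-> p (m - 1 - i).            *)
Definition rev_perm (m : nat) (p : 'S_m) : 'S_m :=
  (perm (@rev_ord_inj m) * p)%g.

Lemma rev_permE (m : nat) (p : 'S_m) (i : 'I_m) : rev_perm p i = p (rev_ord i).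
Proof. by rewrite permM permE. Qed.

Definition rev_patterns (Pi : patterns) : patterns :=
  fun m => [set rev_perm p | p in Pi m].

Definition contains (n m : nat) (s : 'S_n) (p : 'S_m) : bool :=
  [exists f : {ffun 'I_m -> 'I_n},
    [forall i : 'I_m, forall j : 'I_m, (i < j) ==> (f i < f j)] &&
    [forall i : 'I_m, forall j : 'I_m, (s (f i) < s (f j)) == (p i < p j)]].

Definition avoiders (n : nat) (Pi : patterns) : {set 'S_n} :=
  [set s | `[< forall (m : nat) (p : 'S_m), p \in Pi m -> ~~ contains s p >]].

(* The set [n-1] is 'I_n.-1: its element i stands for i + 1 and for the pair   *)
(* of consecutive positions (lpos i, rpos i) = (i, i + 1) of 'I_n.             *)
Definition lpos (n : nat) (i : 'I_n.-1) : 'I_n := widen_ord (leq_pred n) i.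

Lemma rpos_subproof (n : nat) (i : 'I_n.-1) : i.+1 < n.
Proof. by rewrite -ltn_predRL. Qed.

Definition rpos (n : nat) (i : 'I_n.-1) : 'I_n := Ordinal (rpos_subproof i).

Definition Des (n : nat) (s : 'S_n) : {set 'I_n.-1} :=
  [set i | s (rpos i) < s (lpos i)].

(* Formal power series over R in the countably many variables x_0, x_1, ...:   *)
(* the multiset m stands for the monomial \prod_i x_i ^ (m i), and a series is *)
(* the family of its coefficients.                                             *)
Definition series (R : Type) := {mset nat} -> R.

(* Invariance under x_i |-> x_(g i) for all permutations g of the variables.   *)
Definition symmetric_series (R : Type) (f : series R) : Prop :=
  forall g : nat -> nat, bijective g ->
  forall m : {mset nat}, f (seq_mset [seq g i | i <- m]) = f m.

(* The series \sum_(w : I -> nat | P w) \prod_(i : I) x_(w i). The words w     *)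
(* whose monomial is m only take values in the support of m, so the            *)
(* coefficient of m is a finite count.                                         *)
Definition genfun (R : nzRingType) (I : finType) (P : pred {ffun I -> nat}) :
    series R :=
  fun m => (#|[set w : {ffun I -> finsupp m} |
               P [ffun i => val (w i)] &&
               (seq_mset [seq val (w i) | i : I] == m)]|%:R)%R.

Definition fundamental (R : nzRingType) (n : nat) (S : {set 'I_n.-1}) :
    series R :=
  genfun R (fun w : {ffun 'I_n -> nat} =>
    [forall i : 'I_n.-1, w (lpos i) <= w (rpos i)] &&
    [forall i : 'I_n.-1, (i \in S) ==> (w (lpos i) < w (rpos i))]).

Definition Q (R : nzRingType) (n : nat) (Pi : patterns) : series R :=
  fun m => (\sum_(s in avoiders n Pi) fundamental R (Des s) m)%R.

Definition is_partition (n : nat) (la : seq nat) : bool :=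
  [&& sorted geq la, 0 \notin la & sumn la == n].

Record partition_of (n : nat) : predArgType := PartitionOf {
  parts :> seq nat;
  partsP : is_partition n parts
}.

HB.instance Definition _ (n : nat) := [isSub for @parts n].
HB.instance Definition _ (n : nat) := [Choice of partition_of n by <:].

(* Finiteness: a partition of n is encoded by its parts padded with zeros.     *)
Definition partition_pad (n : nat) (la : partition_of n) :
    {ffun 'I_n -> 'I_n.+1} := [ffun i : 'I_n => inord (nth 0 la i)].

Definition partition_unpad (n : nat) (f : {ffun 'I_n -> 'I_n.+1}) :
    option (partition_of n) :=
  insub [seq x <- [seq val (f i) | i <- enum 'I_n] | x != 0].

Lemma leq_sumn_mem (s : seq nat) (x : nat) : x \in s -> x <= sumn s.
Proof.
elim: s => //= y s IHs; rewrite inE => /orP[/eqP->|/IHs]; first exact: leq_addr.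
by move/leq_trans; apply; exact: leq_addl.
Qed.

Lemma leq_size_sumn (s : seq nat) : 0 \notin s -> size s <= sumn s.
Proof.
elim: s => //= y s IHs; rewrite inE negb_or eq_sym => /andP[y0 /IHs].
by rewrite -lt0n in y0; rewrite -add1n; apply: leq_add.
Qed.

Lemma partition_padK (n : nat) :
  pcancel (@partition_pad n) (@partition_unpad n).
Proof.
move=> [la laP]; rewrite /partition_unpad.
suff -> : [seq x <- [seq val (partition_pad (PartitionOf laP) i)
                    | i <- enum 'I_n] | x != 0] = la.
  by rewrite insubT.
have /and3P[_ la0 /eqP sla] := laP.
have szla : size la <= n by rewrite -sla leq_size_sumn.
have -> : [seq val (partition_pad (PartitionOf laP) i) | i <- enum 'I_n]
          = mkseq (nth 0 la) n.
  rewrite /mkseq -val_enum_ord -map_comp; apply: eq_map => i /=.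
  rewrite ffunE /= inordK // ltnS; have [ilt|/(nth_default 0)->//] := ltnP i (size la).
  by have := leq_sumn_mem (mem_nth 0 ilt); rewrite sla.
rewrite -(subnKC szla).
rewrite /mkseq iotaD map_cat filter_cat add0n -/(mkseq _ _) mkseq_nth.
rewrite [X in _ ++ X](_ : _ = [::]); last first.
  apply/eqP; rewrite -(negbK (_ == _)) -has_filter; apply/hasPn => x /mapP[i].
  by rewrite mem_iota => /andP[/(nth_default 0)-> _ ->].
rewrite cats0; apply/all_filterP/allP => x xla.
by apply: contraNneq la0 => <-.
Qed.

HB.instance Definition _ (n : nat) : isCountable (partition_of n) :=
  PCanIsCountable (@partition_padK n).
HB.instance Definition _ (n : nat) : isFinite (partition_of n) :=
  PCanIsFinite (@partition_padK n).

(* Part j (from 0) of the transpose is the number of parts of la that are > j. *)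
Definition conj_seq (la : seq nat) : seq nat :=
  [seq count (fun r => j < r) la | j <- iota 0 (head 0 la)].

Lemma sorted_geq_head (la : seq nat) (r : nat) :
  sorted geq la -> r \in la -> r <= head 0 la.
Proof.
case: la => //= x la; rewrite (path_sortedE (rev_trans leq_trans)).
by case/andP=> /allP xla _; rewrite inE => /orP[/eqP->//|/xla].
Qed.

Lemma conj_seq_partition (n : nat) (la : seq nat) :
  is_partition n la -> is_partition n (conj_seq la).
Proof.
case/and3P=> sla la0 /eqP<-; apply/and3P; split.
- rewrite /conj_seq; apply: (homo_sorted (e := leq)); last exact: iota_sorted.
  by move=> i j ij; apply: sub_count => r; apply: leq_ltn_trans.
- apply/negP => /mapP[j]; rewrite mem_iota add0n /= => jh /esym/eqP.
  apply/negP; rewrite -lt0n -has_count; apply/hasP; exists (head 0 la) => //.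
  by case: (la) jh => //= x l _; rewrite mem_head.
- have: forall r, r \in la -> r <= head 0 la by move=> r; apply: sorted_geq_head.
  rewrite /conj_seq; move: (head 0 la) => h; clear sla la0.
  elim: la => [|x la IHla] lah /=.
    by rewrite sumnE big_map big1.
  rewrite sumnE big_map big_split /=.
  have /eqP := IHla (fun r rla => lah r (mem_behead (s := x :: la) rla)).
  rewrite sumnE big_map => ->; rewrite eqn_add2r.
  rewrite -big_mkcond sum1_count /= -(subnKC (lah x (mem_head x la))).
  rewrite iotaD count_cat add0n.
  rewrite (@eq_in_count _ _ predT) ?count_predT ?size_iota; last first.
    by move=> k; rewrite mem_iota add0n.
  rewrite (@eq_in_count _ _ pred0) ?count_pred0 ?addn0 // => k.
  by rewrite mem_iota => /andP[xk _] /=; apply/negbTE; rewrite -leqNgt.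
Qed.

Definition conj_partition (n : nat) (la : partition_of n) : partition_of n :=
  PartitionOf (conj_seq_partition (partsP la)).

(* Cell (i, j) of the Young diagram (row i, column j, both from 0).            *)
Definition cell (la : seq nat) : finType := {i : 'I_(size la) & 'I_(nth 0 la i)}.
Definition cell_row (la : seq nat) (c : cell la) : nat := tag c.
Definition cell_col (la : seq nat) (c : cell la) : nat := tagged c.

Definition semistandard (la : seq nat) (T : {ffun cell la -> nat}) : bool :=
  [forall c : cell la, forall d : cell la,
    ((cell_row c == cell_row d) && (cell_col c < cell_col d) ==> (T c <= T d)) &&
    ((cell_col c == cell_col d) && (cell_row c < cell_row d) ==> (T c < T d))].

Definition schur (R : nzRingType) (la : seq nat) : series R :=
  genfun R (@semistandard la).

(* Main.v *)
(* Reversal turns Des s into the reversed complement of Des s, so if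
   Q_n(Pi) = \sum_S a_S F_S then Q_n(Pi^r) = \sum_S a_S F_(rev ~S). The
   coefficient of \sum_S a_S F_S at a monomial with exponents k_1, k_2, ...
   counts the S without element inside the consecutive blocks of lengths
   k_1, k_2, ...; that of \sum_S a_S F_(~S) counts the S containing every
   element inside the blocks. Replacing blocks of the first kind by blocks of
   the second kind one at a time, by e_k = \sum_i (-1)^(i-1) h_i e_(k-i), shows
   that the count is invariant under permutation of the blocks for all kinds of
   blocks as soon as it is for the first kind. This gives the symmetry, and also
   that \sum_S a_S F_(rev ~S) = \sum_S a_S F_(~S).

   For Schur functions, standardization gives s_la = \sum_T F_(Des T) over the
   standard tableaux T of shape la, transposition complements Des T, and the
   Bender-Knuth involution gives the symmetry of s_la. The expansion of Q_n(Pi)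
   transfers because the F_S are linearly independent. *)

Require Import Defs.
From mathcomp Require Import all_boot all_order all_algebra all_fingroup.
From mathcomp Require Import finmap multiset.
From mathcomp Require Import boolp zify.

Set Implicit Arguments.
Unset Strict Implicit.
Unset Printing Implicit Defensive.

Import GRing.Theory.
Local Open Scope mset_scope.
Local Open Scope nat_scope.

(** * Signed blocks *)

(* A block (b, k) covers k consecutive positions; d must have the constant value
   b at the k - 1 gaps inside the block, gaps between blocks being free. *)
Fixpoint compat (d : nat -> bool) (B : seq (bool * nat)) : bool :=
  if B is (b, k) :: B' then
    all (fun j => d j == b) (iota 0 k.-1) && compat (fun j => d (k + j)) B'
  else true.

Definition bsize (B : seq (bool * nat)) : nat := sumn (unzip2 B).

Definition blocks (b : bool) (L : seq nat) : seq (bool * nat) :=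
  [seq (b, k) | k <- L].

Lemma bsize_blocks b L : bsize (blocks b L) = sumn L.
Proof. by rewrite /bsize /blocks /unzip2 -map_comp map_id. Qed.

Lemma bsize_cat B1 B2 : bsize (B1 ++ B2) = bsize B1 + bsize B2.
Proof. by rewrite /bsize /unzip2 map_cat sumn_cat. Qed.

Lemma perm_bsize B1 B2 : perm_eq B1 B2 -> bsize B1 = bsize B2.
Proof. by move=> /(perm_map snd) /perm_sumn. Qed.

(** Gap [j] lies between positions [j] and [j.+1], so [compat] reads only those [j] with
    [j.+1 < bsize B]. *)
Lemma eq_compat d d' B :
  (forall j, j.+1 < bsize B -> d j = d' j) -> compat d B = compat d' B.
Proof.
elim: B d d' => //= -[b k] B IHB d d' dd'; congr (_ && _); last first.
  by apply: IHB => j jB; apply: dd'; rewrite /bsize /= -addnS ltn_add2l.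
apply: eq_in_all => j; rewrite mem_iota => jk; rewrite dd' // /bsize /=; lia.
Qed.

Lemma compat_cat d B1 B2 :
  compat d (B1 ++ B2) =
  compat d B1 && compat (fun j => d (bsize B1 + j)) B2.
Proof.
elim: B1 d => //= -[b k] B1 IHB d; rewrite IHB andbA; congr (_ && _).
by apply: eq_compat => j _; rewrite /bsize /= addnA.
Qed.

(** Mirroring [N] positions sends gap [j] to gap [N - j.+2] and reverses the order of the blocks. *)
Lemma compat_rev d B :
  compat d (rev B) = compat (fun j => d (bsize B - j.+2)) B.
Proof.
elim: B d => //= -[b k] B IHB d.
rewrite rev_cons -cats1 compat_cat IHB andbC /= andbT; congr (_ && _).
  have -> : bsize (rev B) = bsize B by apply: perm_bsize; rewrite perm_rev.
  rewrite [bsize (_ :: _)]/bsize /= -/(bsize B).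
  apply/allP/allP => dB j; rewrite mem_iota => jk.
    have := dB (k - j.+2); rewrite mem_iota => /(_ ltac:(lia)).
    by congr (d _ == b); lia.
  have := dB (k - j.+2); rewrite mem_iota => /(_ ltac:(lia)).
  by congr (d _ == b); lia.
apply: eq_compat => j _; congr d.
by rewrite [bsize (_ :: _)]/bsize /= -/(bsize B); lia.
Qed.

Lemma compatN b d L :
  compat (fun j => ~~ d j) (blocks b L) = compat d (blocks (~~ b) L).
Proof.
elim: L d => //= k L IHL d; rewrite IHL; congr (_ && _).
by apply: eq_all => j /=; case: (d j); case: (b).
Qed.

(** The pattern of the hook shape (i+1, 1^(k-1-i)) seen as a ribbon. The guard makes the term at
    [i = k] vanish, which closes the telescoping sum in [compat_split]. *)
Definition hook (d : nat -> bool) (k i : nat) : bool :=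
  (i < k) && (all (fun j => d j == false) (iota 0 i) &&
              all (fun j => d j == true) (iota i (k.-1 - i))).

(** Pieri's rule for h_(i+1) e_(k-i-1): the free gap [i] between the two blocks is [true] in the
    first hook and [false] in the second. If [i.+1 = k] there is no such gap and the second hook is
    0. *)
Lemma compat_hook (R : nzRingType) d k i : i < k ->
  ((compat d [:: (false, i.+1); (true, (k - i.+1)%N)])%:R =
   (hook d k i)%:R + (hook d k i.+1)%:R :> R)%R.
Proof.
move=> i_lt_k; rewrite -natrD; congr (_%:R)%R; rewrite /hook i_lt_k.
have -> : all (fun j => d j == false) (iota 0 i.+1) =
          all (fun j => d j == false) (iota 0 i) && ~~ d i.
  by rewrite -[i.+1]addn1 iotaD all_cat /= andbT add0n; case: (d i).
rewrite /= andbT.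
have -> : all (fun j => d (i.+1 + j) == true) (iota 0 (k - i.+1).-1) =
          all (fun j => d j == true) (iota i.+1 (k - i.+1).-1).
  by have := iotaDl i.+1 0 (k - i.+1).-1; rewrite addn0 => ->; rewrite all_map.
have [ik|ki] /= := ltnP i.+1 k.
  have -> : k.-1 - i = (k - i.+1).-1.+1 by lia.
  have -> : k.-1 - i.+1 = (k - i.+1).-1 by lia.
  by rewrite /=; case: (all _ (iota 0 i)); case: (d i); case: (all _ (iota i.+1 _)).
have -> : (k - i.+1).-1 = 0 by lia.
have -> : k.-1 - i = 0 by lia.
by rewrite /= addn0; case: (all _ _).
Qed.

Lemma natr_andb (R : nzRingType) (b c : bool) :
  ((b && c)%:R = b%:R * c%:R :> R)%R.
Proof. by rewrite -mulnb natrM. Qed.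

Lemma alternating_telescope (R : comNzRingType) (h : nat -> R) (k : nat) :
  (\sum_(i < k) (-1) ^+ i * (h i + h i.+1) = h 0 - (-1) ^+ k * h k)%R.
Proof.
elim: k => [|k IHk]; first by rewrite big_ord0 expr0 mul1r subrr.
rewrite big_ord_recr /= IHk exprS mulrDr mulN1r mulNr opprK addrA.
by rewrite subrK.
Qed.

(* The identity e_k = \sum_(1 <= i <= k) (-1)^(i-1) h_i e_(k-i). *)
Lemma compat_split (R : comNzRingType) d B1 k B2 : 0 < k ->
  ((compat d (B1 ++ (true, k) :: B2))%:R =
   \sum_(i < k) (-1) ^+ i *
     (compat d (B1 ++ [:: (false, i.+1), (true, (k - i.+1)%N) & B2]))%:R :> R)%R.
Proof.
move=> k_gt0; set d1 := fun j => d (bsize B1 + j).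
pose c : R := ((compat d B1)%:R)%R.
pose e : R := ((compat (fun j => d1 (k + j)) B2)%:R)%R.
have -> : (\sum_(i < k) (-1) ^+ i * (compat d (B1 ++
      [:: (false, i.+1), (true, (k - i.+1)%N) & B2]))%:R =
    c * e * \sum_(i < k) (-1) ^+ i *
      ((hook d1 k i)%:R + (hook d1 k i.+1)%:R) :> R)%R.
  rewrite big_distrr; apply: eq_bigr => i _.
  have -> : compat d (B1 ++ [:: (false, i.+1), (true, (k - i.+1)%N) & B2]) =
      compat d B1 && (compat d1 [:: (false, i.+1); (true, (k - i.+1)%N)] &&
        compat (fun j => d1 (k + j)) B2).
    rewrite compat_cat -[[:: _, _ & B2]]/([:: _; _] ++ B2) compat_cat.
    congr (_ && (_ && _)); apply: eq_compat => j _; congr (d (_ + _)).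
    rewrite /bsize /=; have := ltn_ord i; lia.
  rewrite natr_andb natr_andb compat_hook // -/c -/e [RHS]mulrCA.
  by congr (_ * _)%R; rewrite -mulrA; congr (_ * _)%R; rewrite mulrC.
(* Only [hook d1 k 0] survives, which demands [true] at all gaps of the block. *)
rewrite (alternating_telescope (fun i => (hook d1 k i)%:R%R)) {2}/hook ltnn.
rewrite mulr0 subr0 compat_cat /= natr_andb natr_andb -/c -/d1 -/e.
by rewrite /hook k_gt0 subn0 /= -mulrA; congr (_ * _)%R; rewrite mulrC.
Qed.

(** An empty block has no inner gap, so its sign is immaterial. This is the base case of
    [perm_super_coef]. *)
Lemma compat_true0 d B : all (fun bk => bk.1 ==> (bk.2 == 0)) B ->
  compat d B = compat d (blocks false (unzip2 B)).
Proof.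
elim: B d => //= -[b k] B IHB d /andP[/= bk /IHB->].
by case: b bk => //= /eqP->.
Qed.

(** Extended by [false] to all of [nat], so that [compat] can shift it from block to block without a
    change of type. *)
Definition ind (n : nat) (S : {set 'I_n}) (j : nat) : bool :=
  [exists i in S, val i == j].

Lemma indE n (S : {set 'I_n}) (i : 'I_n) : ind S i = (i \in S).
Proof.
by apply/exists_inP/idP => [[j jS /eqP/val_inj<-] //|iS]; exists i.
Qed.

Lemma ind_setC n (S : {set 'I_n}) j : j < n -> ind (~: S) j = ~~ ind S j.
Proof. by move=> jn; rewrite -[j]/(val (Ordinal jn)) !indE inE. Qed.

(* With all signs false this is a coefficient of \sum_S a_S F_S; a block
   (true, k) replaces the factor h_k dual to it by e_k. *)
Definition super_coef (R : comNzRingType) (n : nat) (a : {set 'I_n} -> R)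
    (B : seq (bool * nat)) : R :=
  (\sum_S a S * (compat (ind S) B)%:R)%R.

Lemma super_coef_split (R : comNzRingType) (n : nat) (a : {set 'I_n} -> R) B1 k B2 :
  0 < k ->
  super_coef a (B1 ++ (true, k) :: B2) =
  (\sum_(i < k) (-1) ^+ i *
     super_coef a (B1 ++ [:: (false, i.+1), (true, (k - i.+1)%N) & B2]))%R.
Proof.
move=> k_gt0; rewrite /super_coef.
under [RHS]eq_bigr do rewrite big_distrr.
rewrite exchange_big; apply: eq_bigr => S _; rewrite compat_split //.
by rewrite big_distrr; apply: eq_bigr => i _ /=; rewrite mulrCA.
Qed.

Lemma perm_insert (T : eqType) (u s t s' t' : seq T) :
  perm_eq (s ++ u ++ t) (s' ++ u ++ t') = perm_eq (s ++ t) (s' ++ t').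
Proof. by rewrite perm_catCA perm_sym perm_catCA perm_sym perm_cat2l. Qed.

(** Induction on the total size of the [true] blocks. A nonempty block [(true, k)] occurs in both
    lists; splitting it in both gives sums whose terms match one by one, and each term has a smaller
    total because [k] becomes [k - i.+1]. *)
Lemma perm_super_coef (R : comNzRingType) (n N : nat) (a : {set 'I_n} -> R) :
  (forall L L', sumn L = N -> perm_eq L L' ->
     super_coef a (blocks false L) = super_coef a (blocks false L')) ->
  forall B B', bsize B = N -> perm_eq B B' -> super_coef a B = super_coef a B'.
Proof.
move=> aL B; have [t] := ubnP (sumn [seq bk.2 | bk : bool * nat <- B & bk.1]).
elim: t B => // t IHt B Bt B' BN BB'.
(* If all [true] blocks are empty, every sign may be taken [false] and the hypothesis applies. *)
have [B0|] := boolP (all (fun bk : bool * nat => bk.1 ==> (bk.2 == 0)) B).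
  have B'0 : all (fun bk : bool * nat => bk.1 ==> (bk.2 == 0)) B'.
    by rewrite -(perm_all _ BB').
  rewrite /super_coef; under eq_bigr do rewrite compat_true0 //.
  under [RHS]eq_bigr do rewrite compat_true0 //.
  by apply: aL => //; apply: perm_map.
case/allPn => -[b k] kB; rewrite negb_imply /= => /andP[bT k0].
case: b kB bT => // kB _; rewrite -lt0n in k0.
have kB' : (true, k) \in B' by rewrite -(perm_mem BB').
move: kB kB' Bt BN BB' => /splitPr[B1 B2] /splitPr[B1' B2'] Bt BN BB'.
have {}BB' : perm_eq (B1 ++ B2) (B1' ++ B2').
  by rewrite -(perm_insert [:: (true, k)]).
rewrite !super_coef_split //; apply: eq_bigr => i _; congr (_ * _)%R.
have ik := ltn_ord i; apply: IHt.
- move: Bt; rewrite !filter_cat /= !map_cat !sumn_cat /=; lia.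
- by rewrite -BN !bsize_cat /bsize /=; lia.
- by rewrite (perm_insert [:: (false, i.+1); (true, k - i.+1)]).
Qed.

(** * Coefficients of fundamental quasisymmetric functions *)

Fixpoint strict_at (d : nat -> bool) (s : seq nat) : bool :=
  if s is x :: s' then
    (if s' is y :: _ then d 0 ==> (x < y) else true) &&
    strict_at (fun j => d j.+1) s'
  else true.

Lemma strict_atP (d : nat -> bool) s :
  reflect (forall i, i.+1 < size s -> d i -> nth 0 s i < nth 0 s i.+1)
          (strict_at d s).
Proof.
elim: s d => [|x s IHs] d /=; first by apply: ReflectT.
apply: (iffP andP) => [[d0 /IHs ds] [|i]|ds].
- by case: s d0 {IHs ds} => //= y s /implyP d0 _ /d0.
- by rewrite ltnS => /ds.
split; last by apply/IHs => i; exact: (ds i.+1).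
by case: s ds {IHs} => //= y s ds; apply/implyP => /(ds 0 isT).
Qed.

(** No gap inside the run of [v] can be strict, while the step from the run into [s] is strict
    anyway. The run therefore acts as a [false] block of size [k]. *)
Lemma strict_at_nseq d k v s : all (ltn v) s ->
  strict_at d (nseq k v ++ s) =
  all (fun j => d j == false) (iota 0 k.-1) && strict_at (fun j => d (k + j)) s.
Proof.
move=> vs; elim: k d => [|[|k] IHk] d //.
  by case: s vs {IHk} => //= y s /andP[-> _]; rewrite implybT.
have -> : strict_at d (nseq k.+2 v ++ s) =
  (d 0 ==> (v < v)) && strict_at (fun j => d j.+1) (nseq k.+1 v ++ s) by [].
rewrite IHk ltnn implybF [iota 0 k.+2.-1]/= [all _ (_ :: _)]/= eqbF_neg.
rewrite -andbA; congr (_ && (_ && _)).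
by have := iotaDl 1 0 k; rewrite addn0 => ->; rewrite all_map.
Qed.

Definition word_of_mults (mult : nat -> nat) (vs : seq nat) : seq nat :=
  flatten [seq nseq (mult v) v | v <- vs].

Lemma all_word_of_mults (p : pred nat) mult vs :
  all p vs -> all p (word_of_mults mult vs).
Proof.
elim: vs => //= v vs IHvs /andP[pv /IHvs]; rewrite /word_of_mults /= all_cat => ->.
by rewrite all_nseq pv orbT.
Qed.

Lemma strict_at_word d mult vs : sorted ltn vs ->
  strict_at d (word_of_mults mult vs) =
  compat d (blocks false [seq mult v | v <- vs]).
Proof.
elim: vs d => //= v vs IHvs d; rewrite (path_sortedE ltn_trans) => /andP[vvs /IHvs IH].
by rewrite strict_at_nseq ?IH // all_word_of_mults.
Qed.

Lemma sorted_word mult vs : sorted ltn vs -> sorted leq (word_of_mults mult vs).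
Proof.
elim: vs => //= v vs IHvs; rewrite (path_sortedE ltn_trans) => /andP[vvs /IHvs IH].
rewrite /word_of_mults /= -/(word_of_mults mult vs).
elim: (mult v) => //= k IHk; rewrite (path_sortedE leq_trans) IHk andbT all_cat.
rewrite all_nseq leqnn orbT all_word_of_mults //.
by apply: sub_all vvs => y /ltnW.
Qed.

Definition mults (m : {mset nat}) : seq nat :=
  [seq m v | v <- sort leq (undup m)].

Lemma sorted_undup_mset (m : {mset nat}) : sorted ltn (sort leq (undup m)).
Proof. by rewrite ltn_sorted_uniq_leq sort_uniq undup_uniq sort_sorted //; apply: leq_total. Qed.

Lemma sort_msetE (m : {mset nat}) :
  sort leq m = word_of_mults m (sort leq (undup m)).
Proof.
apply: (sorted_eq leq_trans anti_leq); first by apply: sort_sorted; apply: leq_total.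
  by rewrite sorted_word // sorted_undup_mset.
rewrite perm_sort perm_sym -[X in perm_eq _ X]/(enum_mset m).
rewrite -(permPr (perm_count_undup m)) /word_of_mults.
under eq_map => v do rewrite -count_mem_mset.
by apply/perm_flatten/perm_map; rewrite perm_sort.
Qed.

Lemma sumn_mults (m : {mset nat}) : sumn (mults m) = size m.
Proof.
rewrite -(size_sort leq) sort_msetE /word_of_mults size_flatten /shape -map_comp.
by congr sumn; apply: eq_map => v /=; rewrite size_nseq.
Qed.

Lemma strict_at_mset d (m : {mset nat}) :
  strict_at d (sort leq m) = compat d (blocks false (mults m)).
Proof. by rewrite sort_msetE strict_at_word // sorted_undup_mset. Qed.

Lemma nth_word (T : Type) (x0 : T) n (u : 'I_n -> T) (i : 'I_n) :
  nth x0 [seq u i | i : 'I_n] i = u i.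
Proof. by rewrite (nth_map i) ?size_enum_ord // nth_ord_enum. Qed.

Lemma size_word (T : Type) n (u : 'I_n -> T) : size [seq u i | i : 'I_n] = n.
Proof. by rewrite size_map size_enum_ord. Qed.

(** A weakly increasing word with content [m] must be the sorted list of [m], so at most one word is
    counted. *)
Lemma fundamentalE (R : nzRingType) n (S : {set 'I_n.-1}) m :
  fundamental R S m =
  ((size m == n) && strict_at (ind S) (sort leq m))%:R%R.
Proof.
rewrite /fundamental /genfun; congr (_%:R)%R.
set P := (X in [set w | X w]).
have PE (w : {ffun 'I_n -> finsupp m}) : P w =
    strict_at (ind S) (sort leq m) && ([seq val (w i) | i : 'I_n] == sort leq m).
  rewrite {}/P; apply/idP/idP.
    case/andP=> /andP[/forallP le_w /forallP lt_w] /eqP mE.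
    have wE : [seq val (w i) | i : 'I_n] = sort leq m.
      apply: (sorted_eq leq_trans anti_leq).
      - apply/(sortedP 0) => i; rewrite size_word => i_lt.
        have i_lt' : i < n.-1 by lia.
        have := le_w (Ordinal i_lt'); rewrite !ffunE.
        by rewrite -!(nth_word 0 (fun i => val (w i))).
      - by apply: sort_sorted; apply: leq_total.
      - by have := perm_eq_seq_mset [seq val (w i) | i : 'I_n]; rewrite mE -(perm_sort leq m) perm_sym.
    rewrite wE eqxx andbT; apply/strict_atP => i.
    rewrite -wE size_word => i_lt; have i_lt' : i < n.-1 by lia.
    rewrite -[i]/(val (Ordinal i_lt')) indE => iS.
    have /implyP/(_ iS) := lt_w (Ordinal i_lt'); rewrite !ffunE.
    by rewrite -!(nth_word 0 (fun i => val (w i))).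
  case/andP=> /strict_atP lt_w /eqP wE; rewrite -wE in lt_w.
  apply/andP; split; last first.
    apply/eqP; rewrite -[RHS]seq_mset_id; apply/eq_seq_msetP.
    by rewrite wE perm_sort perm_refl.
  apply/andP; split; apply/forallP => i; have := ltn_ord i => i_lt.
    rewrite !ffunE -!(nth_word 0 (fun i => val (w i))) wE /=.
    apply: (sortedP 0 _); first by apply: sort_sorted; apply: leq_total.
    by rewrite -wE size_word -ltn_predRL.
  rewrite !ffunE -!(nth_word 0 (fun i => val (w i))); apply/implyP => iS.
  by apply: (lt_w i); rewrite ?indE // size_word -ltn_predRL.
have -> : finset P = [set w : {ffun 'I_n -> finsupp m} |
    strict_at (ind S) (sort leq m) && ([seq val (w i) | i : 'I_n] == sort leq m)].
  by apply/setP => w; rewrite !inE PE.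
rewrite andbC; case: (strict_at _ _) => /=; last first.
  by apply: eq_card0 => w; rewrite inE.
have [mn|mn] := eqVneq (size m) n; last first.
  apply: eq_card0 => w; rewrite inE; apply: contra_neqF mn => /eqP wE.
  by rewrite -(size_sort leq) -wE size_word.
have mP (i : 'I_n) : nth 0 (sort leq m) i \in finsupp m.
  by rewrite msuppE -(mem_sort leq) mem_nth // size_sort mn.
apply/eqP/cards1P; exists [ffun i => [` mP i]%fset]; apply/setP => w; rewrite !inE.
apply/eqP/eqP => [wE|->].
  apply/ffunP => i; apply: val_inj; rewrite ffunE /= -wE.
  by rewrite (nth_word 0 (fun i => val (w i))).
apply: (@eq_from_nth _ 0); rewrite size_word ?size_sort ?mn // => i i_lt.
by rewrite -[i]/(val (Ordinal i_lt)) (nth_word 0 (fun i => val (_ i))) ffunE.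
Qed.

Lemma fundamental_compat (R : nzRingType) n (S : {set 'I_n.-1}) m :
  fundamental R S m =
  ((size m == n) && compat (ind S) (blocks false (mults m)))%:R%R.
Proof. by rewrite fundamentalE strict_at_mset. Qed.

(** * Symmetry of combinations of fundamentals *)

(** The monomial with exponent [nth 0 L v] at variable [v]. Zero exponents are allowed, whereas
    [mults] lists only the nonzero ones. *)
Definition mset_of_mults (L : seq nat) : {mset nat} :=
  seq_mset (word_of_mults (nth 0 L) (iota 0 (size L))).

Lemma sort_seq_mset s : sorted leq s -> sort leq (seq_mset s) = s.
Proof.
move=> ss; apply: (sorted_eq leq_trans anti_leq) => //.
  by apply: sort_sorted; apply: leq_total.
by rewrite perm_sort perm_eq_seq_mset.
Qed.

Lemma size_seq_mset (s : seq nat) : size (seq_mset s) = size s.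
Proof. exact/perm_size/perm_eq_seq_mset. Qed.

Lemma size_mset_of_mults L : size (mset_of_mults L) = sumn L.
Proof.
rewrite size_seq_mset /word_of_mults size_flatten /shape -map_comp.
rewrite -[in RHS](mkseq_nth 0 L) /mkseq; congr sumn.
by apply: eq_map => v /=; rewrite size_nseq.
Qed.

Lemma fundamental_mset_of_mults (R : nzRingType) n (S : {set 'I_n.-1}) L :
  fundamental R S (mset_of_mults L) =
  ((sumn L == n) && compat (ind S) (blocks false L))%:R%R.
Proof.
rewrite fundamentalE size_mset_of_mults sort_seq_mset; last first.
  by rewrite sorted_word // iota_ltn_sorted.
rewrite strict_at_word ?iota_ltn_sorted //.
by rewrite -[X in blocks _ X]/(mkseq (nth 0 L) (size L)) mkseq_nth.
Qed.

(** Turns a rearrangement of exponents into a renaming of variables, the only operation that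
    [symmetric_series] knows. *)
Lemma perm_mset_of_mults L L' : perm_eq L L' ->
  exists2 g : nat -> nat, bijective g &
    seq_mset [seq g i | i <- mset_of_mults L] = mset_of_mults L'.
Proof.
move/(perm_iotaP 0) => [I pI LE].
have szI : size I = size L' by rewrite (perm_size pI) size_iota.
have uI : uniq I by rewrite (perm_uniq pI) iota_uniq.
have memI v : (v \in I) = (v < size L') by rewrite (perm_mem pI) mem_iota.
(* The default value [i] makes the renaming the identity beyond the indices in [I], hence a
   bijection of [nat]. *)
exists (fun i => nth i I i).
  exists (fun i => if i \in I then index i I else i) => i /=.
    have [ilt|ige] := ltnP i (size I); first by rewrite mem_nth // index_uniq.
    by rewrite nth_default // memI -szI ltnNge ige.
  have [iI|] := boolP (i \in I); first by rewrite nth_index.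
  by rewrite memI -szI -leqNgt => ige; rewrite nth_default.
apply/eq_seq_msetP; rewrite (permPl (perm_map _ (perm_eq_seq_mset _))).
have szL : size L = size I by rewrite LE size_map.
rewrite /word_of_mults map_flatten -map_comp.
rewrite (eq_in_map _ ((fun v => nseq (nth 0 L' v) v) \o nth 0 I) _).1; last first.
  move=> v; rewrite mem_iota /= szL => vI; rewrite map_nseq LE (nth_map 0) //.
  by rewrite (set_nth_default 0).
rewrite map_comp szL -[X in map _ X]/(mkseq (nth 0 I) (size I)) mkseq_nth.
by apply/perm_flatten/perm_map.
Qed.

Definition qsym (R : nzRingType) n (a : {set 'I_n.-1} -> R) : series R :=
  fun m => (\sum_S a S * fundamental R S m)%R.

Definition perm_invariant (R : comNzRingType) n (a : {set 'I_n.-1} -> R) : Prop :=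
  forall L L', sumn L = n -> perm_eq L L' ->
    super_coef a (blocks false L) = super_coef a (blocks false L').

Lemma qsym_mset_of_mults (R : comNzRingType) n (a : {set 'I_n.-1} -> R) L :
  sumn L = n -> qsym a (mset_of_mults L) = super_coef a (blocks false L).
Proof.
move=> Ln; apply: eq_bigr => S _.
by rewrite fundamental_mset_of_mults Ln eqxx.
Qed.

Lemma symmetric_perm_invariant (R : comNzRingType) n (a : {set 'I_n.-1} -> R) :
  symmetric_series (qsym a) -> perm_invariant a.
Proof.
move=> sym_a L L' Ln LL'; have [g bij_g gE] := perm_mset_of_mults LL'.
rewrite -!qsym_mset_of_mults //; last by rewrite -(perm_sumn LL').
by rewrite -gE sym_a.
Qed.

Lemma perm_mults (g : nat -> nat) (m : {mset nat}) : injective g ->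
  perm_eq (mults (seq_mset [seq g i | i <- m])) (mults m).
Proof.
move=> g_inj; rewrite /mults; set m' := seq_mset _.
have -> : [seq m v | v <- sort leq (undup m)] =
          [seq m' v | v <- [seq g v | v <- sort leq (undup m)]].
  rewrite -map_comp; apply: eq_map => v /=.
  by rewrite mset_seqE count_map -count_mem_mset; apply: eq_count => u /=; rewrite (inj_eq g_inj).
apply: perm_map; apply: uniq_perm.
- by rewrite sort_uniq undup_uniq.
- by rewrite map_inj_uniq // sort_uniq undup_uniq.
move=> v; rewrite mem_sort mem_undup (perm_mem (perm_eq_seq_mset _)).
by apply: eq_mem_map => u; rewrite mem_sort mem_undup.
Qed.

Definition rev_set n (S : {set 'I_n}) : {set 'I_n} := [set i | rev_ord i \in S].

(** A [false] block for the complement of [S] is a [true] block for [S]. *)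
Lemma qsym_compl (R : comNzRingType) n (a : {set 'I_n.-1} -> R) m :
  (\sum_S a S * fundamental R (~: S) m =
   if size m == n then super_coef a (blocks true (mults m)) else 0)%R.
Proof.
under eq_bigr do rewrite fundamental_compat.
case: eqP => [mn|_] /=; last by rewrite big1 // => S _; rewrite mulr0.
apply: eq_bigr => S _; congr (_ * _%:R)%R; rewrite -(compatN false).
rewrite (@eq_compat _ (fun j => ~~ ind S j)) // => j.
by rewrite bsize_blocks sumn_mults mn => jn; rewrite ind_setC // ltn_predRL.
Qed.

Lemma qsym_rev_compl (R : comNzRingType) n (a : {set 'I_n.-1} -> R) m :
  (\sum_S a S * fundamental R (rev_set (~: S)) m =
   if size m == n then super_coef a (rev (blocks true (mults m))) else 0)%R.
Proof.
under eq_bigr do rewrite fundamental_compat.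
case: eqP => [mn|_] /=; last by rewrite big1 // => S _; rewrite mulr0.
apply: eq_bigr => S _; congr (_ * _%:R)%R.
rewrite compat_rev bsize_blocks sumn_mults mn -(compatN false).
rewrite (@eq_compat _ (fun j => ~~ ind S (n - j.+2))) // => j.
rewrite bsize_blocks sumn_mults mn -ltn_predRL => jn.
rewrite -[j]/(val (Ordinal jn)) indE !inE -indE /=.
by congr (~~ ind S _); lia.
Qed.

(** Both sides are given by the same [true] blocks, read in opposite orders, and the order is
    irrelevant by [perm_super_coef]. *)
Lemma qsym_rev_compl_perm_invariant (R : comNzRingType) n
    (a : {set 'I_n.-1} -> R) m : perm_invariant a ->
  (\sum_S a S * fundamental R (rev_set (~: S)) m =
   \sum_S a S * fundamental R (~: S) m)%R.
Proof.
move=> sym_a; rewrite qsym_rev_compl qsym_compl; case: eqP => // mn.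
apply: (perm_super_coef sym_a); last by rewrite perm_rev.
by rewrite (perm_bsize (permEl (perm_rev _))) bsize_blocks sumn_mults.
Qed.

(** Without the reversal, renaming the variables merely permutes the exponents, hence the [true]
    blocks. *)
Lemma symmetric_qsym_rev_compl (R : comNzRingType) n (a : {set 'I_n.-1} -> R) :
  perm_invariant a ->
  symmetric_series (fun m => \sum_S a S * fundamental R (rev_set (~: S)) m)%R.
Proof.
move=> sym_a g /bij_inj g_inj m; rewrite !qsym_rev_compl_perm_invariant //.
rewrite !qsym_compl size_seq_mset size_map; case: eqP => // mn.
apply: (perm_super_coef sym_a).
  by rewrite bsize_blocks sumn_mults size_seq_mset size_map.
exact/perm_map/perm_mults.
Qed.

(** * Linear independence of the fundamentals *)

Definition word_of_cuts n (U : {set 'I_n.-1}) : seq nat :=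
  mkseq (fun i => count (ind U) (iota 0 i)) n.

(** The word rises, by 1, exactly at the gaps in [U]. *)
Lemma fundamental_word_of_cuts (R : nzRingType) n (S U : {set 'I_n.-1}) :
  fundamental R S (seq_mset (word_of_cuts U)) = ((S \subset U)%:R)%R.
Proof.
have step i : i.+1 < n -> nth 0 (word_of_cuts U) i.+1 =
    nth 0 (word_of_cuts U) i + ind U i.
  move=> iltn; rewrite !nth_mkseq ?(ltnW iltn) // -[in LHS](addn1 i) iotaD.
  by rewrite count_cat /= addn0.
rewrite fundamentalE size_seq_mset size_mkseq eqxx sort_seq_mset; last first.
  apply/(sortedP 0) => i; rewrite size_mkseq => iltn.
  by rewrite step // leq_addr.
congr (_%:R)%R; congr nat_of_bool; apply/strict_atP/subsetP.
  move=> lt_w i iS; have iltn := ltn_ord i; rewrite -indE.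
  have := lt_w i; rewrite indE size_mkseq -ltn_predRL => /(_ iltn iS).
  by rewrite step -?ltn_predRL //; case: (ind U i) => //; rewrite addn0 ltnn.
move=> SU i; rewrite size_mkseq => iltn; rewrite step //.
move: iltn; rewrite -ltn_predRL => iltn.
by rewrite -[i in ind _ i]/(val (Ordinal iltn)) indE => /SU; rewrite -indE /= => ->; rewrite addn1.
Qed.

(** The coefficient at [word_of_cuts S] is the sum of [a T] over the subsets [T] of [S]. This
    triangular system is solved by induction on the cardinality of [S]. *)
Lemma qsym_inj (R : nzRingType) n (a b : {set 'I_n.-1} -> R) :
  qsym a =1 qsym b -> a =1 b.
Proof.
move=> ab S; have [k] := ubnP #|S|; elim: k S => // k IHk S Sk.
have := ab (seq_mset (word_of_cuts S)); rewrite /qsym.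
under eq_bigr do rewrite fundamental_word_of_cuts.
under [in RHS]eq_bigr do rewrite fundamental_word_of_cuts.
rewrite (bigD1 S) // [in RHS](bigD1 S) //= subxx !mulr1.
rewrite (eq_bigr (fun T => b T * (T \subset S)%:R)%R) => [/addIr //|T TS].
have [sub|] := boolP (T \subset S); last by rewrite !mulr0.
rewrite IHk // (leq_trans _ (Sk : #|S| <= k)) //.
by apply: proper_card; rewrite properEneq TS.
Qed.

(** Serves to collect terms by descent set, with [phi] the identity, the complement or the reversed
    complement. *)
Lemma sum_fibers (R : nzRingType) n (J : finType) (A : pred J) (c : J -> R)
    (D : J -> {set 'I_n.-1}) (phi : {set 'I_n.-1} -> {set 'I_n.-1}) m :
  (\sum_(j | A j) c j * fundamental R (phi (D j)) m =
   \sum_S (\sum_(j | A j && (D j == S)) c j) * fundamental R (phi S) m)%R.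
Proof.
rewrite (partition_big D predT) //=; apply: eq_bigr => S _.
by rewrite big_distrl /=; apply: eq_bigr => j /andP[_ /eqP->].
Qed.

(** * Reversal of permutations *)

Lemma rev_permK n : involutive (@rev_perm n).
Proof. by move=> s; apply/permP => i; rewrite !rev_permE rev_ordK. Qed.

Lemma Des_rev n (s : 'S_n) : Des (rev_perm s) = rev_set (~: Des s).
Proof.
apply/setP => i; rewrite !inE !rev_permE -leqNgt ltn_neqAle.
have -> : rev_ord (rpos i) = lpos (rev_ord i).
  by apply: val_inj => /=; have := ltn_ord i; lia.
have -> : rev_ord (lpos i) = rpos (rev_ord i).
  by apply: val_inj => /=; have := ltn_ord i; lia.
(* Adjacent values differ by injectivity, so a gap that is not a descent is a strict ascent. *)
rewrite andb_idl // => _; apply/eqP => /val_inj/perm_inj/(congr1 val) /=; lia.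
Qed.

Lemma contains_rev n m (s : 'S_n) (p : 'S_m) :
  contains s p -> contains (rev_perm s) (rev_perm p).
Proof.
case/existsP => f /andP[/forallP f_incr /forallP f_iso].
(* Reversing both source and target keeps the embedding increasing. *)
apply/existsP; exists [ffun i => rev_ord (f (rev_ord i))].
apply/andP; split; apply/forallP => i; apply/forallP => j; rewrite !ffunE.
  have /forallP/(_ (rev_ord i))/implyP fij := f_incr (rev_ord j).
  apply/implyP => ij; rewrite /= ltn_sub2lE //; apply: fij => /=; have := ltn_ord j; lia.
rewrite !rev_permE !rev_ordK.
by have /forallP/(_ (rev_ord j)) := f_iso (rev_ord i).
Qed.

Lemma mem_avoiders_rev n (Pi : patterns) (s : 'S_n) :
  (rev_perm s \in avoiders n (rev_patterns Pi)) = (s \in avoiders n Pi).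
Proof.
rewrite !inE; apply/asboolP/asboolP => s_av m p pPi; apply/negP.
  by move/contains_rev; apply/negP/s_av; apply: imset_f.
case/imsetP: pPi => q qPi -> /contains_rev; rewrite !rev_permK.
exact/negP/s_av.
Qed.

Lemma Q_rev (R : nzRingType) n (Pi : patterns) m :
  Q R n (rev_patterns Pi) m =
  (\sum_(s in avoiders n Pi) fundamental R (rev_set (~: Des s)) m)%R.
Proof.
rewrite /Q (reindex_inj (inv_inj (@rev_permK n))).
by apply: eq_big => s; [apply: mem_avoiders_rev | rewrite Des_rev].
Qed.

(** * Standardization *)

Definition word_le (I : finType) (le : rel I) (w : I -> nat) : rel I :=
  fun c d => (w c < w d) || (w c == w d) && le c d.

(** At these gaps a tie would be broken the other way, so a word sorted along [tau] has to rise
    strictly there. *)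
Definition label_Des (I : finType) (le : rel I) n (tau : 'I_n -> I) :
    {set 'I_n.-1} :=
  [set i | ~~ le (tau (lpos i)) (tau (rpos i))].

Lemma sum_card_exchange (S T : finType) (A : pred S) (B : S -> pred T) :
  \sum_(s | A s) #|[set t | B s t]| = \sum_t #|[set s | A s && B s t]|.
Proof.
under eq_bigr do rewrite -sum1dep_card.
rewrite (exchange_big_dep predT) //=; apply: eq_bigr => t _.
by rewrite -sum1dep_card; apply: eq_bigl => s; rewrite andbC.
Qed.

Lemma word_le_total (I : finType) (le : rel I) w : total le -> total (word_le le w).
Proof.
move=> le_total c d; rewrite /word_le; by case: (ltngtP (w c) (w d)) => //= _.
Qed.

Lemma word_le_trans (I : finType) (le : rel I) w :
  transitive le -> transitive (word_le le w).
Proof.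
move=> le_trans d c e /orP[cd|/andP[/eqP cd lcd]] /orP[de|/andP[/eqP de lde]];
  rewrite /word_le.
- by rewrite (ltn_trans cd de).
- by rewrite -de cd.
- by rewrite cd de.
- by rewrite cd de eqxx (le_trans _ _ _ lcd lde) orbT.
Qed.

Lemma word_le_anti (I : finType) (le : rel I) w :
  antisymmetric le -> antisymmetric (word_le le w).
Proof.
move=> le_anti c d; rewrite /word_le; case: (ltngtP (w c) (w d)) => //= _.
exact: le_anti.
Qed.

(* Sorting the elements of I by value, with ties broken by le, splits a word w uniquely
   into a linear arrangement tau and a word w \o tau counted by F_(Des tau). *)
Lemma genfun_standardize (R : nzRingType) (I : finType) (le : rel I) (n : nat)
    (P : pred {ffun I -> nat}) (lin : pred {ffun 'I_n -> I}) m :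
  #|I| = n -> total le -> antisymmetric le -> transitive le ->
  (forall (tau : {ffun 'I_n -> I}) (w : {ffun I -> nat}), injective tau ->
     (forall i j : 'I_n, i < j -> word_le le w (tau i) (tau j)) ->
     P w = lin tau) ->
  genfun R P m =
  (\sum_(tau : {ffun 'I_n -> I} | injectiveb tau && lin tau)
     fundamental R (label_Des le tau) m)%R.
Proof.
move=> cardI le_total le_anti le_trans P_lin.
rewrite /fundamental /genfun -natr_sum; congr (_%:R)%R.
pose compatible (tau : 'I_n -> I) (w : I -> nat) :=
  [forall i : 'I_n.-1, w (tau (lpos i)) <= w (tau (rpos i))] &&
  [forall i : 'I_n.-1, (i \in label_Des le tau) ==>
     (w (tau (lpos i)) < w (tau (rpos i)))].
pose content (w : {ffun I -> finsupp m}) := seq_mset [seq val (w c) | c : I] == m.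
have tau_bij (tau : {ffun 'I_n -> I}) : injective tau -> bijective tau.
  by move=> tau_inj; apply: inj_card_bij; rewrite ?cardI ?card_ord.
have permI (tau : {ffun 'I_n -> I}) : injective tau ->
    perm_eq [seq tau i | i : 'I_n] (enum I).
  move=> tau_inj; apply: uniq_perm; rewrite ?enum_uniq //.
    by rewrite map_inj_uniq // enum_uniq.
  move=> c; rewrite mem_enum inE; apply/imageP.
  by have [g _ gK] := tau_bij _ tau_inj; exists (g c); rewrite ?gK.
have compatibleE (tau : {ffun 'I_n -> I}) (w : I -> nat) :
    compatible tau w = sorted (word_le le w) [seq tau i | i : 'I_n].
  have nthE (i : 'I_n) c0 := nth_word c0 tau i.
  apply/andP/idP => [[/forallP le_w /forallP lt_w]|].
    have [n0|/card_gt0P[i0 _]] := posnP #|'I_n|.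
      by rewrite (size0nil (_ : size [seq tau i | i : 'I_n] = 0)) // size_image.
    apply/(sortedP (tau i0)) => i; rewrite size_word => i_lt.
    have i_lt' : i < n.-1 by rewrite ltn_predRL.
    have := le_w (Ordinal i_lt'); have := lt_w (Ordinal i_lt').
    rewrite -(nthE (lpos _) (tau i0)) -(nthE (rpos _) (tau i0)) !inE.
    rewrite -(nthE (lpos _) (tau i0)) -(nthE (rpos _) (tau i0)) /= /word_le.
    by case: ltngtP => //= _; case: (le _ _).
  move=> w_sorted; have w_le (i : 'I_n.-1) :
      word_le le w (tau (lpos i)) (tau (rpos i)).
    rewrite -(nthE (lpos _) (tau (lpos i))) -(nthE (rpos _) (tau (lpos i))).
    apply: (sortedP (tau (lpos i)) w_sorted).
    rewrite size_word; exact: rpos_subproof.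
  split; apply/forallP => i; have := w_le i; rewrite ?inE /word_le.
    by case: ltngtP.
  by case: ltngtP => //= _; rewrite ?implybT // => ->.
have strictly (tau : {ffun 'I_n -> I}) (w : I -> nat) : compatible tau w ->
    forall i j : 'I_n, i < j -> word_le le w (tau i) (tau j).
  rewrite compatibleE => w_sorted i j ij.
  rewrite -(nth_word (tau i) tau i) -(nth_word (tau i) tau j).
  by apply: (sorted_ltn_nth (word_le_trans le_trans)) => //;
    rewrite inE size_word.
(* Since [word_le] is a total order, each word is compatible with exactly one injective arrangement,
   the sorted one. *)
have [sorting sortingP] : exists sorting : (I -> nat) -> {ffun 'I_n -> I},
    forall w (tau : {ffun 'I_n -> I}),
      (injectiveb tau && compatible tau w) = (tau == sorting w).
  have sz w : size (sort (word_le le w) (enum I)) = n.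
    by rewrite size_sort -cardE.
  exists (fun w => [ffun i => tnth (Tuple (introT eqP (sz w))) i]) => w tau.
  set tau0 := finfun _.
  have tau0E : [seq tau0 i | i : 'I_n] = sort (word_le le w) (enum I).
    transitivity (tval (Tuple (introT eqP (sz w)))) => //.
    rewrite -[RHS]map_tnth_enum; apply: eq_map => i; exact: ffunE.
  apply/andP/eqP => [[/injectiveP tau_inj]|->].
    rewrite compatibleE => w_sorted; apply/ffunP => i.
    have tauE : [seq tau i | i : 'I_n] = [seq tau0 i | i : 'I_n].
      rewrite tau0E; apply: (sorted_eq (word_le_trans (w := w) le_trans)) => //.
      - exact: word_le_anti.
      - by apply: sort_sorted; apply: word_le_total.
      - by rewrite perm_sym perm_sort perm_sym permI.
    have := congr1 (fun s => nth (tau i) s i) tauE.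
    by rewrite !nth_word.
  rewrite compatibleE tau0E; split; last by apply: sort_sorted; apply: word_le_total.
  by change (uniq [seq tau0 i | i : 'I_n]); rewrite tau0E sort_uniq enum_uniq.
(* For fixed [tau], composition with [tau] matches words on [I] with words on positions and
   preserves the content. *)
have fiberE (tau : {ffun 'I_n -> I}) : injective tau ->
    #|[set u : {ffun 'I_n -> finsupp m} |
       ([forall i : 'I_n.-1, [ffun i => val (u i)] (lpos i) <=
            [ffun i => val (u i)] (rpos i)] &&
        [forall i : 'I_n.-1, (i \in label_Des le tau) ==>
           ([ffun i => val (u i)] (lpos i) < [ffun i => val (u i)] (rpos i))]) &&
       (seq_mset [seq val (u i) | i : 'I_n] == m)]| =
    #|[set w : {ffun I -> finsupp m} |
       compatible tau (fun c => val (w c)) && content w]|.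
  move=> tau_inj; have [g tauK gK] := tau_bij _ tau_inj.
  pose phi (w : {ffun I -> finsupp m}) := [ffun i => w (tau i)].
  have phi_inj : injective phi.
    move=> w w' /ffunP ww'; apply/ffunP => c.
    by have := ww' (g c); rewrite !ffunE gK.
  rewrite -(card_imset _ phi_inj); apply: eq_card => u.
  have -> : u = phi [ffun c => u (g c)].
    by apply/ffunP => i; rewrite !ffunE tauK.
  move: [ffun c => u (g c)] => w; rewrite mem_imset // !inE /content.
  congr (_ && _).
    congr (_ && _); apply: eq_forallb => i; rewrite !ffunE //.
  congr (_ == _); apply/eq_seq_msetP.
  rewrite (_ : [seq val (phi w i) | i : 'I_n] =
               [seq val (w c) | c <- [seq tau i | i : 'I_n]]).
    exact/perm_map/permI.
  by rewrite -map_comp; apply: eq_map => i /=; rewrite ffunE.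
rewrite (eq_bigr (fun tau : {ffun 'I_n -> I} => #|[set w : {ffun I -> finsupp m} |
    compatible tau (fun c => val (w c)) && content w]|)); last first.
  by move=> tau /andP[/injectiveP tau_inj _]; apply: fiberE.
(* Double counting: for each word [w] only [tau = sorting w] can contribute. *)
rewrite sum_card_exchange -sum1dep_card big_mkcond; apply: eq_bigr => w _.
pose w' : {ffun I -> nat} := [ffun c => val (w c)].
have w'E tau : compatible tau (fun c => val (w c)) = compatible tau w'.
  congr (_ && _); apply: eq_forallb => i; rewrite ?ffunE //.
under eq_finset do rewrite w'E andbACA sortingP.
have := sortingP w' (sorting w'); rewrite eqxx.
move=> /andP[/injectiveP tau_inj /strictly tau_le].
rewrite -/(content w) (P_lin _ w' tau_inj tau_le).
case: (boolP (lin (sorting w') && content w)) => [lin_w|not_lin_w].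
  rewrite (_ : [set _ | _] = [set sorting w']) ?cards1 //.
  by apply/setP => tau; rewrite !inE; case: eqP => // ->.
apply/esym/eqP; rewrite cards_eq0; apply/eqP/setP => tau; rewrite !inE.
by case: eqP => // ->; apply: negbTE.
Qed.

(** * Standard tableaux and transposition *)

Lemma cell_col_lt la (c : cell la) : cell_col c < nth 0 la (cell_row c).
Proof. exact: ltn_ord. Qed.

Lemma cell_of la i j : j < nth 0 la i ->
  {c : cell la | cell_row c = i & cell_col c = j}.
Proof.
move=> j_lt; have i_lt : i < size la.
  by rewrite ltnNge; apply/negP => /(nth_default 0) i_ge; rewrite i_ge in j_lt.
by exists (Tagged (fun i : 'I_(size la) => 'I_(nth 0 la i))
                  (Ordinal j_lt : 'I_(nth 0 la (Ordinal i_lt)))).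
Qed.

Lemma cell_inj la (c d : cell la) :
  cell_row c = cell_row d -> cell_col c = cell_col d -> c = d.
Proof.
case: c d => [i j] [i' j']; rewrite /cell_row /= => /val_inj ii'.
by case: i' / ii' j' => j' /val_inj /= ->.
Qed.

Lemma card_cell la : #|cell la| = sumn la.
Proof.
rewrite card_tagged -[in RHS](mkseq_nth 0 la) /mkseq -val_enum_ord -map_comp.
by congr sumn; apply: eq_map => i /=; rewrite card_ord.
Qed.

(** Reading order: rows from the last to the first, each from left to right. On equal entries of a
    semistandard tableau this is the order by column. *)
Definition cell_le la : rel (cell la) := fun c d =>
  (cell_row d < cell_row c) ||
  (cell_row c == cell_row d) && (cell_col c <= cell_col d).

Lemma cell_le_total la : total (@cell_le la).
Proof. move=> c d; rewrite /cell_le; lia. Qed.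

Lemma cell_le_trans la : transitive (@cell_le la).
Proof. move=> c d e; rewrite /cell_le; lia. Qed.

Lemma cell_le_anti la : antisymmetric (@cell_le la).
Proof.
by move=> c d; rewrite /cell_le => cd; apply: cell_inj; move: cd; lia.
Qed.

(** A standard tableau is encoded by its inverse: [tau i] is the cell with entry [i]. *)
Definition standard la n (tau : {ffun 'I_n -> cell la}) : bool :=
  [forall i : 'I_n, forall j : 'I_n,
    ((cell_row (tau i) == cell_row (tau j)) &&
       (cell_col (tau i) < cell_col (tau j)) ==> (i < j)) &&
    ((cell_col (tau i) == cell_col (tau j)) &&
       (cell_row (tau i) < cell_row (tau j)) ==> (i < j))].

Lemma tau_surj la n (tau : {ffun 'I_n -> cell la}) :
  sumn la = n -> injective tau -> forall c, exists i, c = tau i.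
Proof.
move=> la_n tau_inj c.
have [|g _ gK] := inj_card_bij tau_inj; first by rewrite card_cell la_n card_ord.
by exists (g c); rewrite gK.
Qed.

(** Ties within a row favour the left cell and ties within a column the lower one. Hence the weak
    inequality in rows and the strict one in columns both say which of the two cells [tau] lists
    first. *)
Lemma semistandard_sort la n (tau : {ffun 'I_n -> cell la})
    (T : {ffun cell la -> nat}) :
  sumn la = n -> injective tau ->
  (forall i j : 'I_n, i < j -> word_le (@cell_le la) T (tau i) (tau j)) ->
  semistandard T = standard tau.
Proof.
move=> la_n tau_inj T_le; apply/idP/idP.
  move=> /forallP ssT; apply/forallP => i; apply/forallP => j.
  have /forallP/(_ (tau j)) := ssT (tau i).
  case: (ltngtP i j) => [_|ji|/val_inj->]; rewrite ?implybT //; last by rewrite !ltnn !andbF.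
  have := T_le _ _ ji; rewrite /word_le /cell_le.
  move: (cell_row _) (cell_row _) (cell_col _) (cell_col _) (T _) (T _).
  by move=> *; lia.
move=> /forallP st; apply/forallP => c; apply/forallP => d.
have [[i ->] [j ->]] := (tau_surj la_n tau_inj c, tau_surj la_n tau_inj d).
have /forallP/(_ j) := st i.
case: (ltngtP i j) => [ij|ji|/val_inj->]; last by rewrite !ltnn !andbF.
  have := T_le _ _ ij; rewrite /word_le /cell_le.
  move: (cell_row _) (cell_row _) (cell_col _) (cell_col _) (T _) (T _).
  by move=> *; lia.
by rewrite !implybF => /andP[/negbTE-> /negbTE->].
Qed.

Lemma schur_standard (R : nzRingType) n la m : sumn la = n ->
  schur R la m =
  (\sum_(tau : {ffun 'I_n -> cell la} | injectiveb tau && standard tau)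
     fundamental R (label_Des (@cell_le la) tau) m)%R.
Proof.
move=> la_n; apply: genfun_standardize.
- by rewrite card_cell.
- exact: cell_le_total.
- exact: cell_le_anti.
- exact: cell_le_trans.
- by move=> tau T tau_inj; apply: semistandard_sort.
Qed.

Lemma geq_nth la i j : sorted geq la -> i <= j -> nth 0 la j <= nth 0 la i.
Proof.
move=> sla ij; have [j_lt|/(nth_default 0)-> //] := ltnP j (size la).
apply: (sorted_leq_nth (rev_trans leq_trans) leqnn 0 sla) => //.
by rewrite inE (leq_ltn_trans ij).
Qed.

(** In a weakly decreasing list the parts exceeding [j] form an initial segment. *)
Lemma ltn_count_sorted la i j :
  sorted geq la -> (i < count (fun r => j < r) la) = (j < nth 0 la i).
Proof.
elim: la i => [|x la IHla] i /=; first by rewrite nth_nil.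
rewrite (path_sortedE (rev_trans leq_trans)) => /andP[/allP xla sla].
have [jx|xj] := ltnP j x; first by case: i => //= i; rewrite add1n ltnS IHla.
rewrite add0n IHla //.
have nth_le k : nth 0 la k <= x.
  by have [/(mem_nth 0)/xla //|/(nth_default 0)->] := ltnP k (size la).
case: i => [|i] /=; first by have := nth_le 0; lia.
by have := nth_le i; have := nth_le i.+1; lia.
Qed.

Lemma ltn_nth_conj la i j :
  sorted geq la -> (i < nth 0 (conj_seq la) j) = (j < nth 0 la i).
Proof.
move=> sla; rewrite -[RHS]ltn_count_sorted //.
suff -> : nth 0 (conj_seq la) j = count (fun r => j < r) la by [].
have [j_lt|j_ge] := ltnP j (head 0 la).
  by rewrite (nth_map 0) ?size_iota // nth_iota.
rewrite nth_default ?size_map ?size_iota //; apply/esym/eqP.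
by rewrite -leqn0 leqNgt ltn_count_sorted // nth0 -leqNgt.
Qed.

Lemma transpose_cell la : sorted geq la ->
  exists2 phi : cell la -> cell (conj_seq la), bijective phi &
    forall c, cell_row (phi c) = cell_col c /\ cell_col (phi c) = cell_row c.
Proof.
move=> sla.
have phiP (c : cell la) : cell_row c < nth 0 (conj_seq la) (cell_col c).
  by rewrite ltn_nth_conj // cell_col_lt.
have psiP (c : cell (conj_seq la)) : cell_row c < nth 0 la (cell_col c).
  by rewrite -ltn_nth_conj // cell_col_lt.
exists (fun c => s2val (cell_of (phiP c))); last first.
  by move=> c; case: (cell_of (phiP c)).
exists (fun c => s2val (cell_of (psiP c))) => c.
  case: (cell_of (phiP c)) => d /= dr dc; case: (cell_of (psiP d)) => e /= er ec.
  by apply: cell_inj; rewrite ?er ?ec.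
case: (cell_of (psiP c)) => d /= dr dc; case: (cell_of (phiP d)) => e /= er ec.
by apply: cell_inj; rewrite ?er ?ec.
Qed.

Lemma standard_index_le la n (tau : {ffun 'I_n -> cell la}) (i j : 'I_n) :
  sorted geq la -> sumn la = n -> injective tau -> standard tau ->
  cell_row (tau i) <= cell_row (tau j) -> cell_col (tau i) <= cell_col (tau j) ->
  i <= j.
Proof.
move=> sla la_n tau_inj /forallP st row_ij col_ij.
(* The corner reached along the row of [tau i] and then down the column to [tau j]; it lies in the
   diagram because the rows weakly decrease. *)
have [|c cr cc] := @cell_of la (cell_row (tau i)) (cell_col (tau j)).
  exact: leq_trans (cell_col_lt _) (geq_nth sla row_ij).
have [k ck] := tau_surj la_n tau_inj c; rewrite {c}ck in cr cc.
have /forallP/(_ k)/andP[+ _] := st i; have /forallP/(_ j)/andP[_] := st k.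
rewrite cr cc !eqxx /= => kj ik; apply: (@leq_trans k).
  move: col_ij ik; rewrite leq_eqVlt => /orP[/eqP col_ij _|-> /ltnW //].
  by rewrite (tau_inj i k) //; apply: cell_inj; rewrite ?cr ?cc.
move: row_ij kj; rewrite leq_eqVlt => /orP[/eqP row_ij _|-> /ltnW //].
by rewrite (tau_inj k j) //; apply: cell_inj; rewrite ?cr ?cc.
Qed.

(** The cell of the next entry is neither weakly above and weakly left of the current one, nor
    strictly below and strictly right of it. It is thus either below and weakly left (a descent) or
    right and weakly above (none), and transposition swaps the two cases. *)
Lemma standard_Des_transpose la n (tau : {ffun 'I_n -> cell la})
    (phi : cell la -> cell (conj_seq la)) :
  sorted geq la -> sumn la = n -> injective tau -> standard tau ->
  (forall c, cell_row (phi c) = cell_col c /\ cell_col (phi c) = cell_row c) ->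
  label_Des (@cell_le _) (phi \o tau) = ~: label_Des (@cell_le _) tau.
Proof.
move=> sla la_n tau_inj st phiE; apply/setP => i; rewrite !inE negbK /cell_le /=.
have [-> ->] := phiE (tau (lpos i)); have [-> ->] := phiE (tau (rpos i)).
have not_nw : ~~ ((cell_row (tau (rpos i)) <= cell_row (tau (lpos i))) &&
                  (cell_col (tau (rpos i)) <= cell_col (tau (lpos i)))).
  apply/negP => /andP[row_le col_le].
  by have := standard_index_le sla la_n tau_inj st row_le col_le; rewrite /= ltnn.
have not_se : ~~ ((cell_row (tau (lpos i)) < cell_row (tau (rpos i))) &&
                  (cell_col (tau (lpos i)) < cell_col (tau (rpos i)))).
  apply/negP => /andP[row_lt col_lt].
  (* The entry of this corner would lie strictly between two consecutive entries. *)
  have [|c cr cc] := @cell_of la (cell_row (tau (lpos i))) (cell_col (tau (rpos i))).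
    exact: leq_trans (cell_col_lt _) (geq_nth sla (ltnW row_lt)).
  have [k ck] := tau_surj la_n tau_inj c; rewrite {c}ck in cr cc.
  have ik : lpos i <= k 
    by apply: (standard_index_le sla la_n tau_inj st); rewrite ?cr ?cc // ltnW.
  have ki : k <= rpos i 
    by apply: (standard_index_le sla la_n tau_inj st); rewrite ?cr ?cc // ltnW.
  have [kE|kE] : k = lpos i \/ k = rpos i.
    have [<-|ik'] := eqVneq (lpos i) k; [by left | right; apply: val_inj].
    by move: ik ik' ki; rewrite -(inj_eq val_inj) /=; lia.
  - by rewrite -cc kE ltnn in col_lt.
  - by rewrite -cr kE ltnn in row_lt.
move: (cell_row _) (cell_row _) (cell_col _) (cell_col _) not_nw not_se.
by move=> *; lia.
Qed.

Lemma schur_conj (R : nzRingType) n (la : partition_of n) m :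
  schur R (conj_partition la) m =
  (\sum_(tau : {ffun 'I_n -> cell la} | injectiveb tau && standard tau)
     fundamental R (~: label_Des (@cell_le la) tau) m)%R.
Proof.
have /and3P[sla _ /eqP la_n] := partsP la.
have /and3P[_ _ /eqP conj_n] := partsP (conj_partition la).
have [phi phi_bij phiE] := transpose_cell sla.
have phi_inj := bij_inj phi_bij.
pose transpose (tau : {ffun 'I_n -> cell la}) : {ffun 'I_n -> cell (conj_seq la)} :=
  [ffun i => phi (tau i)].
have tr_bij : bijective transpose.
  have [psi phiK psiK] := phi_bij.
  exists (fun tau : {ffun 'I_n -> cell (conj_seq la)} => [ffun i => psi (tau i)]) => tau;
    by apply/ffunP => i; rewrite !ffunE.
have tr_inj tau : injectiveb (transpose tau) = injectiveb tau.
  apply/injectiveP/injectiveP => tau_inj i j.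
    by move=> tau_ij; apply: tau_inj; rewrite !ffunE tau_ij.
  by rewrite !ffunE => /phi_inj/tau_inj.
have tr_std tau : standard (transpose tau) = standard tau.
  apply: eq_forallb => i; apply: eq_forallb => j; rewrite !ffunE.
  have [-> ->] := phiE (tau i); have [-> ->] := phiE (tau j).
  exact: andbC.
rewrite (schur_standard R m conj_n) (reindex transpose); last exact: onW_bij.
apply: eq_big => tau; first by rewrite tr_inj tr_std.
rewrite tr_inj tr_std => /andP[/injectiveP tau_inj tau_std].
rewrite -(standard_Des_transpose sla la_n tau_inj tau_std phiE).
by congr (fundamental R _ m); apply/setP => i; rewrite !inE !ffunE.
Qed.

(** * The Bender-Knuth involution *)

(** Adjacent transpositions generate all rearrangements. *)
Lemma adjacent_swap_perm (A : Type) (f : seq nat -> A) :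
  (forall L1 a b L2, f (L1 ++ [:: a, b & L2]) = f (L1 ++ [:: b, a & L2])) ->
  forall L L', perm_eq L L' -> f L = f L'.
Proof.
move=> f_swap.
have f_move x M L1 L2 : f (L1 ++ x :: M ++ L2) = f (L1 ++ M ++ x :: L2).
  elim: M L1 => //= y M IHM L1.
  by rewrite f_swap -cat_rcons IHM cat_rcons.
move=> L L'; rewrite -[f L]/(f ([::] ++ L)) -[f L']/(f ([::] ++ L')).
elim: L L' [::] => [|x L IHL] L' pre LL'.
  by move: LL'; rewrite perm_sym => /perm_nilP->.
have xL' : x \in L' by rewrite -(perm_mem LL') mem_head.
case/splitPr: xL' LL' => M1 M2 LL'.
have {}LL' : perm_eq L (M1 ++ M2).
  by move: LL'; rewrite -cat1s perm_sym -(cat1s x M2) perm_catCA perm_cat2l perm_sym.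
by rewrite -cat_rcons (IHL _ _ LL') cat_rcons f_move.
Qed.

Lemma semistandard_row la (T : {ffun cell la -> nat}) c d :
  semistandard T -> cell_row c = cell_row d -> cell_col c <= cell_col d ->
  T c <= T d.
Proof.
move=> /forallP/(_ c)/forallP/(_ d)/andP[/implyP T_row _] rcd.
rewrite leq_eqVlt => /orP[/eqP ccd|ccd]; first by rewrite (cell_inj rcd ccd).
by apply: T_row; rewrite rcd eqxx.
Qed.

Lemma semistandard_col la (T : {ffun cell la -> nat}) c d :
  semistandard T -> cell_col c = cell_col d -> cell_row c < cell_row d ->
  T c < T d.
Proof.
move=> /forallP/(_ c)/forallP/(_ d)/andP[_ /implyP T_col] ccd rcd.
by apply: T_col; rewrite ccd eqxx.
Qed.

(* As v varies, these row lengths form the Gelfand-Tsetlin pattern of T. *)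
Definition row_len la (T : {ffun cell la -> nat}) (v i : nat) : nat :=
  \max_(c : cell la | (cell_row c == i) && (T c < v)) (cell_col c).+1.

(** Rows weakly increase, so the entries below [v] fill an initial segment. *)
Lemma ltn_row_len la (T : {ffun cell la -> nat}) v c : semistandard T ->
  (cell_col c < row_len T v (cell_row c)) = (T c < v).
Proof.
move=> ssT; apply/idP/idP => [|Tcv]; last first.
  rewrite /row_len (bigmax_sup c) ?eqxx //.
rewrite ltnNge; apply: contraNT; rewrite -leqNgt => vTc.
apply/bigmax_leqP => d /andP[/eqP rdc Tdv].
rewrite ltnNge; apply/negP => ccd.
by have := semistandard_row ssT (esym rdc) ccd; lia.
Qed.

Lemma row_len_leq la (T : {ffun cell la -> nat}) v i : row_len T v i <= nth 0 la i.
Proof. by apply/bigmax_leqP => c /andP[/eqP<- _]; apply: cell_col_lt. Qed.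

Lemma row_len_unique la (T : {ffun cell la -> nat}) v i x : x <= nth 0 la i ->
  (forall c, cell_row c = i -> (cell_col c < x) = (T c < v)) -> row_len T v i = x.
Proof.
move=> x_le xP; apply/eqP; rewrite eqn_leq; apply/andP; split.
  by apply/bigmax_leqP => c /andP[/eqP /xP->].
case: x x_le xP => // j j_lt xP; have [c cr cc] := cell_of j_lt.
by rewrite /row_len -cc (bigmax_sup c) // -xP // cr cc eqxx ltnSn.
Qed.

Lemma row_len_mono la (T : {ffun cell la -> nat}) v v' i :
  v <= v' -> row_len T v i <= row_len T v' i.
Proof.
move=> vv'; apply/bigmax_leqP => c /andP[cr cv].
by rewrite /row_len (bigmax_sup c) // cr (leq_trans cv).
Qed.

(** Columns strictly increase: the cell above an entry at most [v] has an entry less than [v]. *)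
Lemma row_len_interlace la (T : {ffun cell la -> nat}) v i :
  sorted geq la -> semistandard T -> row_len T v.+1 i.+1 <= row_len T v i.
Proof.
move=> sla ssT; apply/bigmax_leqP => c /andP[/eqP cr cv].
have [|d dr dc] := @cell_of la i (cell_col c).
  by apply: leq_trans (cell_col_lt c) _; rewrite cr geq_nth.
rewrite -dc -dr ltn_row_len //.
by have := semistandard_col ssT dc; rewrite dr cr ltnSn => /(_ isT); lia.
Qed.

Lemma card_row la i x : x <= nth 0 la i ->
  #|[set c : cell la | (cell_row c == i) && (cell_col c < x)]| = x.
Proof.
move=> x_le.
have lt_i (j : 'I_x) : j < nth 0 la i by apply: leq_trans (ltn_ord j) x_le.
pose f (j : 'I_x) := s2val (cell_of (lt_i j)).
have fr j : cell_row (f j) = i by rewrite /f; case: (cell_of _).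
have fc j : cell_col (f j) = j by rewrite /f; case: (cell_of _).
have f_inj : injective f by move=> j k jk; apply: val_inj; rewrite /= -!fc jk.
rewrite -[RHS](card_ord x) -(card_imset _ f_inj); apply: eq_card => c.
rewrite inE; apply/idP/imsetP => [/andP[/eqP cr cx]|[j _ ->]]; last by rewrite fr fc eqxx ltn_ord.
by exists (Ordinal cx) => //; apply: cell_inj; rewrite ?fr ?fc.
Qed.

Lemma card_lt_row_len la (T : {ffun cell la -> nat}) v : semistandard T ->
  #|[set c | T c < v]| = \sum_(i < size la) row_len T v i.
Proof.
move=> ssT; rewrite -sum1dep_card.
rewrite (partition_big (fun c : cell la => tag c) predT) //=.
apply: eq_bigr => i _; rewrite -[RHS](@card_row la i) ?row_len_leq //.
rewrite -sum1dep_card; apply: eq_bigl => c.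
rewrite -[tag c == i](inj_eq val_inj) -[val (tag c)]/(cell_row c) andbC.
by case: eqP => //= <-; rewrite ltn_row_len.
Qed.

Lemma card_eq_lt la (T : {ffun cell la -> nat}) v :
  #|[set c | T c < v.+1]| = #|[set c | T c < v]| + #|[set c | T c == v]|.
Proof.
rewrite -[LHS](cardsID [set c | T c < v]); congr (_ + _); apply: eq_card => c;
  by rewrite !inE; lia.
Qed.

(** With levels [k] and [k.+2] of the pattern fixed, interlacing confines row [i] of level [k.+1] to
    the interval from [bk_lo] to [bk_hi]. Row 0 has no row above to bound it. *)
Definition bk_lo la (T : {ffun cell la -> nat}) k i : nat :=
  maxn (row_len T k i) (row_len T k.+2 i.+1).

Definition bk_hi la (T : {ffun cell la -> nat}) k i : nat :=
  if i is i'.+1 then minn (row_len T k.+2 i) (row_len T k i')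
  else row_len T k.+2 i.

Definition bk_len la (T : {ffun cell la -> nat}) k i : nat :=
  bk_lo T k i + bk_hi T k i - row_len T k.+1 i.

(* The Bender-Knuth involution in Gelfand-Tsetlin form: the length of the row of
   entries < k+1 is reflected in the interval of its admissible values. *)
Definition bk la (k : nat) (T : {ffun cell la -> nat}) : {ffun cell la -> nat} :=
  [ffun c => if k <= T c < k.+2 then
               if cell_col c < bk_len T k (cell_row c) then k else k.+1
             else T c].

Lemma bk_bounds la (T : {ffun cell la -> nat}) k i :
  sorted geq la -> semistandard T ->
  bk_lo T k i <= row_len T k.+1 i <= bk_hi T k i.
Proof.
move=> sla ssT; rewrite /bk_lo /bk_hi geq_max row_len_mono ?leqnSn //=.
rewrite row_len_interlace //=; case: i => [|i]; first by rewrite row_len_mono ?leqnSn.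
by rewrite leq_min row_len_mono ?leqnSn ?row_len_interlace.
Qed.

Lemma bk_len_bounds la (T : {ffun cell la -> nat}) k i :
  sorted geq la -> semistandard T ->
  bk_lo T k i <= bk_len T k i <= bk_hi T k i.
Proof. by move=> sla ssT; have := bk_bounds k i sla ssT; rewrite /bk_len; lia. Qed.

Lemma bk_len_leq la (T : {ffun cell la -> nat}) k i :
  sorted geq la -> semistandard T ->
  row_len T k i <= bk_len T k i <= row_len T k.+2 i.
Proof.
move=> sla ssT; have := bk_len_bounds k i sla ssT; rewrite /bk_lo /bk_hi.
by case: i => [|i]; lia.
Qed.

Lemma bk_lt_low la (T : {ffun cell la -> nat}) k v c : v <= k ->
  (bk k T c < v) = (T c < v).
Proof. by rewrite ffunE => vk; case: (_ < bk_len _ _ _); case: ifP; lia. Qed.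

Lemma bk_lt_high la (T : {ffun cell la -> nat}) k v c : k.+2 <= v ->
  (bk k T c < v) = (T c < v).
Proof. by rewrite ffunE => vk; case: (_ < bk_len _ _ _); case: ifP; lia. Qed.

Lemma bk_lt_mid la (T : {ffun cell la -> nat}) k c :
  sorted geq la -> semistandard T ->
  (bk k T c < k.+1) = (cell_col c < bk_len T k (cell_row c)).
Proof.
move=> sla ssT; rewrite ffunE; have := bk_len_leq k (cell_row c) sla ssT.
have := ltn_row_len k c ssT; have := ltn_row_len k.+2 c ssT.
by case: (ltnP (cell_col c) (bk_len _ _ _)) => ?; case: ifP; lia.
Qed.

Lemma bk_semistandard la (T : {ffun cell la -> nat}) k :
  sorted geq la -> semistandard T -> semistandard (bk k T).
Proof.
move=> sla ssT; apply/forallP => c; apply/forallP => d; apply/andP; split.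
  apply/implyP => /andP[/eqP rcd ccd].
  have Tcd := semistandard_row ssT rcd (ltnW ccd).
  by rewrite !ffunE rcd; do ?[case: ifP => ?]; lia.
apply/implyP => /andP[/eqP ccd rcd]; have Tcd := semistandard_col ssT ccd rcd.
have [/andP[kc dk]|] := boolP ((k <= T c) && (T d < k.+2)); last first.
  by rewrite !ffunE; do ?[case: ifP => ?]; lia.
(* The entries of [c] and [d] are now [k] and [k.+1], and column strictness leaves no room for a
   cell between them. *)
have rowE : cell_row d = (cell_row c).+1.
  apply/eqP; rewrite eqn_leq rcd andbT leqNgt; apply/negP => gap.
  have [|e er ec] := @cell_of la (cell_row c).+1 (cell_col d).
    by apply: leq_trans (cell_col_lt d) _; rewrite geq_nth // ltnW.
  have := semistandard_col (c := c) (d := e) ssT; rewrite ec er ccd => /(_ erefl (ltnSn _)).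
  have := semistandard_col (c := e) (d := d) ssT; rewrite ec er => /(_ erefl gap).
  by lia.
(* The lower bound in the row of [c] forces its new entry to be [k]; the upper bound in the row of
   [d] forces [k.+1]. *)
have := bk_len_bounds k (cell_row c) sla ssT.
have := bk_len_bounds k (cell_row d) sla ssT; rewrite rowE /bk_lo /bk_hi.
have := ltn_row_len k c ssT; have := ltn_row_len k.+2 d ssT; rewrite rowE.
by rewrite !ffunE rowE ccd; do ?[case: ifP => ?]; lia.
Qed.

Lemma row_len_bk la (T : {ffun cell la -> nat}) k v i :
  sorted geq la -> semistandard T ->
  row_len (bk k T) v i = if v == k.+1 then bk_len T k i else row_len T v i.
Proof.
move=> sla ssT; have [->|v_neq] := eqVneq.
  apply: row_len_unique => [|c <-]; last by rewrite bk_lt_mid.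
  have := bk_len_leq k i sla ssT; have := row_len_leq T k.+2 i; lia.
apply: eq_bigl => c; congr (_ && _).
have [vk|kv] := leqP v k; first by rewrite bk_lt_low.
by rewrite bk_lt_high // ltn_neqAle eq_sym v_neq.
Qed.

(** The interval depends only on levels [k] and [k.+2], which [bk] preserves, so the second
    reflection restores level [k.+1]. *)
Lemma bkK la (T : {ffun cell la -> nat}) k :
  sorted geq la -> semistandard T -> bk k (bk k T) = T.
Proof.
move=> sla ssT; apply/ffunP => c.
have neq_k : (k == k.+1) = false by lia.
have neq_k2 : (k.+2 == k.+1) = false by lia.
have lenE i : bk_len (bk k T) k i = row_len T k.+1 i.
  have := bk_bounds k i sla ssT; rewrite /bk_len /bk_lo /bk_hi.
  by case: i => [|i]; rewrite !row_len_bk // eqxx neq_k neq_k2 /bk_len /bk_lo /bk_hi; lia.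
rewrite ffunE lenE ltn_row_len // [bk k T c]ffunE.
have [Tk|/negbTE Tk] := boolP (k <= T c < k.+2); last by rewrite !Tk.
by case: (_ < bk_len _ _ _); do ?[case: ifP => ?]; lia.
Qed.

(** [bk_lo T k i] and [bk_hi T k i.+1] are the maximum and the minimum of the same two numbers. *)
Lemma sum_bk_bounds la (T : {ffun cell la -> nat}) k l :
  \sum_(i < l) bk_lo T k i + \sum_(i < l.+1) bk_hi T k i =
  \sum_(i < l) row_len T k i + \sum_(i < l.+1) row_len T k.+2 i.
Proof.
elim: l => [|l IHl]; first by rewrite !big_ord0 !big_ord_recr !big_ord0.
rewrite big_ord_recr [in X in _ + X]big_ord_recr /=.
rewrite [in RHS]big_ord_recr [in X in _ = _ + X]big_ord_recr /=.
by rewrite addnACA IHl [in RHS]addnACA /bk_lo /bk_hi /=; lia.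
Qed.

(** Old and new lengths in a row add up to [bk_lo + bk_hi]. Summed over the rows, this says that the
    multiplicities of [k] and [k.+1] are exchanged. *)
Lemma card_bk_mid la (T : {ffun cell la -> nat}) k :
  sorted geq la -> semistandard T ->
  #|[set c | bk k T c < k.+1]| + #|[set c | T c < k.+1]| =
  #|[set c | T c < k]| + #|[set c | T c < k.+2]|.
Proof.
move=> sla ssT; rewrite !card_lt_row_len ?bk_semistandard //.
(* The index [size la] is past the last row, so the extra terms of [sum_bk_bounds] vanish. *)
have row_end v : row_len T v (size la) = 0.
  by apply/eqP; rewrite -leqn0 -(nth_default 0 (leqnn (size la))) row_len_leq.
have hi_end : bk_hi T k (size la) = 0.
  by have := row_end k.+2; rewrite /bk_hi; case: (size la) => [|i] -> //; rewrite min0n.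
have := sum_bk_bounds T k (size la).
rewrite big_ord_recr [in X in _ = _ + X]big_ord_recr /= hi_end row_end !addn0.
move=> <-; rewrite -!big_split /=; apply: eq_bigr => i _.
rewrite row_len_bk // eqxx /bk_len.
by have := bk_bounds k i sla ssT; lia.
Qed.

Lemma card_bk la (T : {ffun cell la -> nat}) k v :
  sorted geq la -> semistandard T ->
  #|[set c | bk k T c == v]| =
  #|[set c | T c == if v == k then k.+1 else if v == k.+1 then k else v]|.
Proof.
move=> sla ssT.
have lowE u : u <= k -> #|[set c | bk k T c < u]| = #|[set c | T c < u]|.
  by move=> uk; apply: eq_card => c; rewrite !inE bk_lt_low.
have highE u : k.+2 <= u -> #|[set c | bk k T c < u]| = #|[set c | T c < u]|.
  by move=> uk; apply: eq_card => c; rewrite !inE bk_lt_high.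
have mid := card_bk_mid k sla ssT.
have Tk := card_eq_lt T k; have Tk1 := card_eq_lt T k.+1.
have := card_eq_lt (bk k T) v.
case: (ltngtP v k) => [vk|kv|->].
- by rewrite !lowE // ?(ltnW vk) // card_eq_lt ltn_eqF ?ltnS ?(ltnW vk) // => /addnI.
- case: (eqVneq v k.+1) => [->|v_neq].
    by rewrite (highE k.+2) //; lia.
  by rewrite !highE ?card_eq_lt; first (by move=> /addnI); lia.
- by rewrite (lowE k) //; lia.
Qed.

Lemma count_word_of_mults mult vs v : uniq vs ->
  count_mem v (word_of_mults mult vs) = if v \in vs then mult v else 0.
Proof.
elim: vs => //= u vs IHvs /andP[u_vs /IHvs IH].
rewrite /word_of_mults /= count_cat -/(word_of_mults mult vs) IH count_nseq /=.
by rewrite in_cons [v == u]eq_sym; case: eqP u_vs => [<- /negbTE->|_ _]; rewrite ?mul1n ?addn0.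
Qed.

Lemma mset_of_multsE L v : mset_of_mults L v = nth 0 L v.
Proof.
rewrite mset_seqE count_word_of_mults ?iota_uniq // mem_iota /=.
by case: ltnP => // /(nth_default 0)->.
Qed.

Lemma count_mem_word (I : finType) (w : I -> nat) v :
  count_mem v [seq w c | c : I] = #|[set c | w c == v]|.
Proof. by rewrite count_map cardsE cardE size_filter -enumT. Qed.

(** * Symmetry of Schur functions *)

(** Values in ['I_N] give all contents one ambient type, so that an injection can compare different
    contents. *)
Definition words_of_mults (I : finType) (P : pred {ffun I -> nat}) N (L : seq nat) :
    {set {ffun I -> 'I_N}} :=
  [set w : {ffun I -> 'I_N} | P [ffun c => val (w c)] &&
           [forall v : 'I_N, #|[set c | val (w c) == v]| == nth 0 L v]].

Lemma genfun_mset_of_mults (R : nzRingType) (I : finType)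
    (P : pred {ffun I -> nat}) N L : size L = N ->
  genfun R P (mset_of_mults L) = (#|words_of_mults P N L|%:R)%R.
Proof.
move=> szL; rewrite /genfun; congr (_%:R)%R; set m := mset_of_mults L.
have lt_N (x : finsupp m) : val x < N.
  have := valP x; rewrite mem_finsupp mset_of_multsE -szL ltnNge.
  by apply: contraNN => /(nth_default 0)->.
pose phi (w : {ffun I -> finsupp m}) := [ffun c => Ordinal (lt_N (w c))].
have phi_inj : injective phi.
  move=> w w' /ffunP ww'; apply/ffunP => c; apply: val_inj.
  by have /(congr1 val) := ww' c; rewrite !ffunE.
have content (w : I -> nat) : (forall c, w c < N) ->
    (seq_mset [seq w c | c : I] == m) =
    [forall v : 'I_N, #|[set c | w c == v]| == nth 0 L v].
  move=> w_lt; apply/mset_eqP/forallP => wL v.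
    by rewrite -count_mem_word -mset_seqE wL mset_of_multsE.
  rewrite mset_seqE count_mem_word mset_of_multsE.
  have [v_lt|v_ge] := ltnP v N; first exact/eqP/(wL (Ordinal v_lt)).
  rewrite nth_default ?szL //; apply: eq_card0 => c; rewrite inE.
  by apply: contraTF (w_lt c) => /eqP->; rewrite -leqNgt.
rewrite -(card_imset _ phi_inj); apply: eq_card => u; rewrite inE.
apply/imsetP/idP => [[w + ->]|/andP[Pu /forallP uL]].
  rewrite inE (content (fun c => val (w c))) // => /andP[Pw wL].
  apply/andP; split.
    by congr (is_true (P _)): Pw; apply/ffunP => c; rewrite !ffunE.
  by apply/forallP => v; rewrite -(eqP (forallP wL v)); apply/eqP/eq_card => c;
    rewrite !inE ffunE.
have um c : val (u c) \in finsupp m.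
  rewrite mem_finsupp mset_of_multsE -(eqP (uL (u c))) -lt0n card_gt0.
  by apply/set0Pn; exists c; rewrite inE.
exists [ffun c => [` um c]%fset]; last first.
  by apply/ffunP => c; apply: val_inj; rewrite !ffunE.
rewrite inE (content (fun c => val ([ffun c => [` um c]%fset] c))); last first.
  by move=> c; rewrite ffunE /=.
apply/andP; split.
  by congr (is_true (P _)): Pu; apply/ffunP => c; rewrite !ffunE.
by apply/forallP => v; rewrite -(eqP (uL v)); apply/eqP/eq_card => c;
  rewrite !inE ffunE.
Qed.

Lemma nth_swap L1 a b L2 v (k := size L1) :
  nth 0 (L1 ++ [:: a, b & L2]) v =
  nth 0 (L1 ++ [:: b, a & L2]) (if v == k then k.+1 else if v == k.+1 then k else v).
Proof.
rewrite /k; have [->|v_k] := eqVneq v (size L1).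
  by rewrite !nth_cat ltnn subnn ltnNge leqnSn /= subSnn.
have [->|v_k1] := eqVneq v (size L1).+1.
  by rewrite !nth_cat ltnn subnn ltnNge leqnSn /= subSnn.
rewrite !nth_cat; case: ltnP => // v_ge.
have -> : v - size L1 = (v - (size L1).+2).+2 by lia.
by [].
Qed.

(** [bk k] is injective on semistandard tableaux and swaps the multiplicities at positions [k] and
    [k.+1]. Exchanging [a] and [b] gives the reverse inequality. *)
Lemma leq_card_tableaux_swap la N L1 a b L2 : sorted geq la ->
  size (L1 ++ [:: a, b & L2]) = N ->
  #|words_of_mults (@semistandard la) N (L1 ++ [:: a, b & L2])| <=
  #|words_of_mults (@semistandard la) N (L1 ++ [:: b, a & L2])|.
Proof.
set k := size L1 => sla szL; have k_lt : k.+1 < N by rewrite -szL size_cat /= -/k; lia.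
pose values (w : {ffun cell la -> 'I_N}) : {ffun cell la -> nat} := [ffun c => val (w c)].
have values_inj : injective values.
  by move=> w w' /ffunP ww'; apply/ffunP => c; apply: val_inj; have := ww' c; rewrite !ffunE.
(* The default [w c] is never taken: since [k.+1 < N], the values of [bk] stay below [N]. *)
pose f (w : {ffun cell la -> 'I_N}) : {ffun cell la -> 'I_N} :=
  [ffun c => insubd (w c) (bk k (values w) c)].
have fE w : values (f w) = bk k (values w).
  apply/ffunP => c; rewrite ffunE [f w c]ffunE val_insubd ifT // !ffunE.
  by have := ltn_ord (w c); rewrite /=; do ?[case: ifP => ?]; lia.
have f_inj : {in words_of_mults (@semistandard la) N (L1 ++ [:: a, b & L2]) &,
    injective f}.
  move=> w w'; rewrite !inE => /andP[ssw _] /andP[ssw' _] /(congr1 values).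
  by rewrite !fE => /(congr1 (bk k)); rewrite !bkK // => /values_inj.
rewrite -(card_in_imset f_inj); apply/subset_leq_card/subsetP => u /imsetP[w + ->].
rewrite !inE => /andP[ssw /forallP wL]; apply/andP; split.
  by rewrite -/(values _) fE bk_semistandard.
apply/forallP => v; rewrite nth_swap -/k; set v' := (X in nth 0 _ X).
have v'_lt : v' < N by rewrite /v'; have := ltn_ord v; do ?[case: ifP => ?]; lia.
rewrite -(eqP (wL (Ordinal v'_lt))); apply/eqP.
transitivity #|[set c | bk k (values w) c == v]|.
  by apply: eq_card => c; rewrite !inE -fE [in RHS]ffunE.
by rewrite card_bk //; apply: eq_card => c; rewrite !inE ffunE.
Qed.

Lemma schur_swap (R : nzRingType) la L1 a b L2 : sorted geq la ->
  schur R la (mset_of_mults (L1 ++ [:: a, b & L2])) =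
  schur R la (mset_of_mults (L1 ++ [:: b, a & L2])).
Proof.
move=> sla; pose N := size (L1 ++ [:: a, b & L2]).
have szN : size (L1 ++ [:: b, a & L2]) = N by rewrite /N !size_cat.
rewrite /schur !(@genfun_mset_of_mults _ _ _ N) //.
by congr (_%:R)%R; apply/eqP; rewrite eqn_leq !leq_card_tableaux_swap.
Qed.

(** * Coefficients in the fundamentals and the transfer to the reversed patterns *)

Definition syt_count (R : nzRingType) n (la : seq nat) (S : {set 'I_n.-1}) : R :=
  (\sum_(tau : {ffun 'I_n -> cell la} |
      (injectiveb tau && standard tau) && (label_Des (@cell_le la) tau == S)) 1)%R.

Lemma schur_qsym (R : nzRingType) n la m : sumn la = n ->
  schur R la m = qsym (@syt_count R n la) m.
Proof.
move=> la_n; rewrite (schur_standard R m la_n) /qsym -(sum_fibers _ _ _ id).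
by apply: eq_bigr => tau _; rewrite mul1r.
Qed.

Lemma schur_conj_qsym (R : nzRingType) n (la : partition_of n) m :
  schur R (conj_partition la) m =
  (\sum_S @syt_count R n la S * fundamental R (~: S) m)%R.
Proof.
rewrite schur_conj -(sum_fibers _ _ _ (@setC _)).
by apply: eq_bigr => tau _; rewrite mul1r.
Qed.

Lemma perm_invariant_syt_count (R : comNzRingType) n la :
  sorted geq la -> sumn la = n -> perm_invariant (@syt_count R n la).
Proof.
move=> sla la_n L L' Ln LL'.
have L'n : sumn L' = n by rewrite -(perm_sumn LL').
rewrite -!qsym_mset_of_mults // -!schur_qsym //.
apply: (adjacent_swap_perm (f := fun L => schur R la (mset_of_mults L))) LL'.
by move=> *; apply: schur_swap.
Qed.

Definition avoider_count (R : nzRingType) n (Pi : patterns) (S : {set 'I_n.-1}) : R :=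
  (\sum_(s in avoiders n Pi | Des s == S) 1)%R.

Lemma Q_qsym (R : nzRingType) n Pi m : Q R n Pi m = qsym (@avoider_count R n Pi) m.
Proof.
rewrite /Q /qsym -(sum_fibers _ _ _ id).
by apply: eq_bigr => tau _; rewrite mul1r.
Qed.

Lemma Q_rev_qsym (R : nzRingType) n Pi m :
  Q R n (rev_patterns Pi) m =
  (\sum_S @avoider_count R n Pi S * fundamental R (rev_set (~: S)) m)%R.
Proof.
rewrite Q_rev -(sum_fibers _ _ _ (fun S => rev_set (~: S))).
by apply: eq_bigr => tau _; rewrite mul1r.
Qed.

Theorem proposition2p4 (R : comNzRingType) (Pi : patterns) (n : nat) (n_gt0 : (0 < n)%N) :
  (symmetric_series (Q R n Pi) -> symmetric_series (Q R n (rev_patterns Pi))) /\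
  (forall c : partition_of n -> R,
    (forall m : {mset nat},
       Q R n Pi m = (\sum_(la : partition_of n) c la * schur R la m)%R) ->
    (forall m : {mset nat},
       Q R n (rev_patterns Pi) m =
       (\sum_(la : partition_of n) c la * schur R (conj_partition la) m)%R)).
Proof.
split=> [symQ g g_bij m|c Qc m].
  rewrite !Q_rev_qsym; apply: (symmetric_qsym_rev_compl _ g_bij).
  apply: symmetric_perm_invariant => h h_bij m'.
  by rewrite -!Q_qsym symQ.
pose a S := (\sum_(la : partition_of n) c la * @syt_count R n la S)%R.
(* Linear independence turns the Schur expansion into an identity between numbers of avoiders and of
   tableaux for each descent set. *)
have aE : @avoider_count R n Pi =1 a.
  apply: qsym_inj => m'; rewrite -Q_qsym Qc /qsym.
  under [RHS]eq_bigr do rewrite big_distrl.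
  rewrite exchange_big; apply: eq_bigr => la _ /=.
  have /and3P[_ _ /eqP la_n] := partsP la.
  rewrite (schur_qsym R m' la_n) /qsym big_distrr /=.
  by apply: eq_bigr => S _ /=; rewrite mulrA.
rewrite Q_rev_qsym; under eq_bigr do rewrite aE big_distrl.
rewrite exchange_big; apply: eq_bigr => la _ /=.
have /and3P[sla _ /eqP la_n] := partsP la.
rewrite schur_conj_qsym.
(* Transposition only complements descent sets; the symmetry of each Schur function supplies the
   missing reversal. *)
rewrite -(qsym_rev_compl_perm_invariant _ (perm_invariant_syt_count R sla la_n)).
by rewrite big_distrr; apply: eq_bigr => S _ /=; rewrite mulrA.
Qed.
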